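(* Let $VS_2$ be the Vicsek set with boundary $V_0=\{q_1,q_2,q_3,q_4\}$, and let $\Delta$ be the Neumann Laplacian on $VS_2$. Then every (real-valued) eigenfunction $u$ of the second smallest eigenvalue of $\Delta$ (i.e. the smallest nonzero eigenvalue of $-\Delta$ with Neumann boundary conditions) attains its maximum and its minimum over $VS_2$ on the boundary $V_0$; that is, $\max_{VS_2}u=\max_{V_0}u$ and $\min_{VS_2}u=\min_{V_0}u$.
   Context: Vicsek set. Let $p_1=(0,1)$, $p_2=(1,1)$, $p_3=(1,0)$, $p_4=(0,0)$, $p_5=(1/2,1/2)$ in $\mathbb{R}^2$ and $F_i(x)=\frac13(x-p_i)+p_i$ for $i=1,\dots,5$. The Vicsek set $VS_2$ is the unique nonempty compact set $K\subset\mathbb{R}^2$ with $K=F_1(K)\cup\dots\cup F_5(K)$. Put $q_i=p_i$ for $i=1,2,3,4$; the boundary is $V_0=\{q_1,q_2,q_3,q_4\}$ (the point $p_5$ is not in the boundary). Graph approximations. $\Gamma_0$ is the complete graph on $V_0$, and $\Gamma_{m+1}=F_1(\Gamma_m)\cup\dots\cup F_5(\Gamma_m)$ (union of vertex sets and of edge sets), with vertex set $V_{m+1}=F_1(V_m)\cup\dots\cup F_5(V_m)$. Then $V_m\subset V_{m+1}$ and $\bigcup_m V_m$ is dense in $VS_2$. Write $x\sim y$ if $x,y$ are joined by an edge in $\Gamma_m$. Energy. For a real function $u$ on $VS_2$ let $E_m(u)=\sum_{\{x,y\}:\,x\sim y\text{ in }\Gamma_m}|u(x)-u(y)|^2$,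 $\mathcal{E}_m(u)=3^{m}E_m(u)$ and $\mathcal{E}(u)=\lim_{m\to\infty}\mathcal{E}_m(u)\in[0,\infty]$. The domain $\operatorname{dom}\mathcal{E}$ is the set of continuous $u:VS_2\to\mathbb{R}$ with $\mathcal{E}(u)<\infty$, and $\mathcal{E}(u,v)$ denotes the bilinear form obtained by polarization. Measure. $\mu$ is the self-similar Borel probability measure on $VS_2$ satisfying $\int f\,d\mu=\frac15\sum_{i=1}^5\int f\circ F_i\,d\mu$ for continuous $f$. Laplacian. $\Delta u=f$ (with $u\in\operatorname{dom}\mathcal{E}$, $f$ continuous) means $\mathcal{E}(u,v)=-\int fv\,d\mu$ for all $v\in\operatorname{dom}\mathcal{E}$ with $v|_{V_0}=0$. Up to a positive multiplicative constant, $\Delta u(x)=\lim_{m\to\infty}15^m\Delta_mu(x)$ for $x\in\bigcup_mV_m\setminus V_0$, where $\Delta_mu(x)=\frac1{\deg x}\sum_{y\sim x}(u(y)-u(x))$ is the graph Laplacian of $\Gamma_m$; such a constant does not affect the eigenfunctions or the ordering of the eigenvalues. Neumann Laplacian. Neumann boundary conditions mean that the graph Laplacian formula is used at all vertices of $V_m$, including those of $V_0$. In weak form: a nonzero $u\in\operatorname{dom}\mathcal{E}$ is a Neumann eigenfunction with eigenvalue $\lambda$ (that is, $-\Delta u=\lambda u$) if $\mathcal{E}(u,v)=\lambda\int uv\,d\mu$ for all $v\in\operatorname{dom}\mathcal{E}$ (with no vanishing requirement on $V_0$). The Neumann eigenvalues are nonnegative and accumulate only at $\infty$; the smallest is $0$,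 with constant eigenfunctions, and ''second smallest'' means the next distinct eigenvalue. *)

(* Defs.v *)
From mathcomp Require Import all_boot all_order all_algebra finmap.
From mathcomp Require Import all_classical all_reals all_analysis.

Set Implicit Arguments.
Unset Strict Implicit.
Unset Printing Implicit Defensive.

Import Order.TTheory GRing.Theory Num.Theory.
Import numFieldNormedType.Exports.

Local Open Scope classical_set_scope.
Local Open Scope ring_scope.

Section Vicsek.
Variable R : realType.

Definition vicsek_corners : seq (R * R) := [:: (0, 1); (1, 1); (1, 0); (0, 0)].

Definition vicsek_centers : seq (R * R) := rcons vicsek_corners (2^-1, 2^-1).

Definition vicsek_map (p x : R * R) : R * R := 3^-1 *: (x - p) + p.

Definition is_vicsek_set (K : set (R * R)) : Prop :=
  [/\ K !=set0, compact K
    & K = \bigcup_(p in [set` vicsek_centers]) (vicsek_map p @` K)].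

Definition vicsek_boundary : {fset R * R} := [fset p in vicsek_corners]%fset.

(* Each edge {x, y} of the m-th graph is stored as the two ordered pairs
   (x, y) and (y, x), hence the factor 1/2 in [graph_energy]. *)
Fixpoint vicsek_edges (m : nat) : {fset (R * R) * (R * R)} :=
  if m is m'.+1 then
    (\bigcup_(p <- vicsek_centers)
       [fset (vicsek_map p e.1, vicsek_map p e.2) | e in vicsek_edges m'])%fset
  else [fset e in (vicsek_boundary `*` vicsek_boundary) | e.1 != e.2]%fset.

Definition graph_energy (m : nat) (u : R * R -> R) : R :=
  2^-1 * \sum_(e <- vicsek_edges m) `|u e.1 - u e.2| ^+ 2.

(* Functions on K are represented by functions on the plane; all the notions
   below only depend on their values on K, which contains all the vertices. *)
Definition energy (u : R * R -> R) : \bar R :=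
  limn (fun m => (3 ^+ m * graph_energy m u)%:E).

Definition dom_energy (K : set (R * R)) (u : R * R -> R) : Prop :=
  {within K, continuous u} /\ (energy u < +oo)%E.

Definition energy_form (u v : R * R -> R) : R :=
  4^-1 * (fine (energy (u \+ v)) - fine (energy (u \- v))).

(* The product sigma-algebra on R * R is the Borel one. *)
Definition self_similar_measure (K : set (R * R))
    (mu : probability (R * R)%type R) : Prop :=
  mu K = 1%E /\
  forall f : R * R -> R, {within K, continuous f} ->
    \int[mu]_(x in K) f x =
    5^-1 * \sum_(p <- vicsek_centers) \int[mu]_(x in K) f (vicsek_map p x).

Definition neumann_eigenfunction (K : set (R * R))
    (mu : probability (R * R)%type R) (lambda : R) (u : R * R -> R) : Prop :=
  [/\ dom_energy K u, exists2 x, K x & u x != 0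
    & forall v, dom_energy K v ->
        energy_form u v = lambda * \int[mu]_(x in K) (u x * v x)].

Definition neumann_eigenvalues (K : set (R * R))
    (mu : probability (R * R)%type R) : set R :=
  [set lambda | exists u, neumann_eigenfunction K mu lambda u].

Definition is_least (A : set R) (x : R) : Prop := A x /\ lbound A x.

Definition second_least (A : set R) (x : R) : Prop :=
  exists2 x0, is_least A x0 & is_least (A `\ x0) x.

End Vicsek.

(* Main.v *)
(* A function vanishing at the centre c splits along the line x = 1/2, so the
   spectral gap E(v, v) >= lambda <v, v> for v(c) = 0 follows from the case of odd
   functions, whose least Rayleigh quotient is attained by compactness and is a
   Neumann eigenvalue.  An eigenfunction u for lambda vanishes at c, and its positive
   part satisfies the equation against every test function vanishing at c.
   Restricted to a corner cell and rescaled, such a solution has a nonnegative source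
   at the outer corner, a sink at the inner one, and eigenvalue at most
   lambda / 15 < lambda; the gap then shows that reflecting a point towards the source
   increases the value.  Iterating over levels, the value at x is at most the value at
   the corner of its quadrant up to the oscillation on cells of level n, which decays
   like (3/5)^n. *)
Require Import Defs.
From mathcomp Require Import all_boot all_order all_algebra finmap.
From mathcomp Require Import all_classical all_reals all_analysis.
From mathcomp Require Import ring lra.

Set Implicit Arguments.
Unset Strict Implicit.
Unset Printing Implicit Defensive.

Import Order.TTheory GRing.Theory Num.Theory.
Import numFieldNormedType.Exports.

Local Open Scope classical_set_scope.
Local Open Scope ring_scope.

(** * The five contractions, the two reflections of the square, and sup-norm closeness *)

Section Geometry.
Variable R : realType.
Implicit Types (p x y : R * R) (b : bool).

(** A nonnegative solution has fluxes of known sign: what passes from a corner cell to the central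
    one is the source at the corner plus a multiple of the mass of that cell. An eigenfunction
    changes sign, so its positive part takes over; the equation may then fail by a point source at
    the centre [c], which tests supported in one quadrant do not see, since they vanish at [c]. The
    factor 15 is 3 for the energy times 5 for the mass. At [lambda] itself the gap is attained by
    [u] and leaves no slack; inside a cell the difference of the two constants absorbs truncation
    errors. Truncation is the technical obstacle. Cutting along a mirror line is harmless for a
    function that vanishes near the line, but a function with value 0 at [c] is merely small there.
    The set meets the line only at [c] and approaches it inside a cone, so the function is small on
    a whole strip; lowering it by a small level makes it vanish there, and the level is sent to 0
    afterwards. *)

Definition vq1 : R * R := (0, 1).
Definition vq2 : R * R := (1, 1).
Definition vq3 : R * R := (1, 0).
Definition vq4 : R * R := (0, 0).
Definition vc : R * R := (2^-1, 2^-1).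

Local Notation q1 := vq1.
Local Notation q2 := vq2.
Local Notation q3 := vq3.
Local Notation q4 := vq4.
Local Notation c := vc.
Local Notation F := (@vicsek_map R).
Local Notation centers := (vicsek_centers R).

Lemma vicsek_mapE p x :
  F p x = (3^-1 * (x.1 - p.1) + p.1, 3^-1 * (x.2 - p.2) + p.2).
Proof. by []. Qed.

Lemma mem_centersP p :
  reflect ([\/ p = q1, p = q2, p = q3 | p = q4] \/ p = c) (p \in centers).
Proof.
rewrite !inE; apply: (iffP idP).
  by move=> /or4P[/eqP|/eqP|/eqP|/orP[/eqP|/eqP]] ->; [left; constructor 1|
    left; constructor 2|left; constructor 3|left; constructor 4|right].
by move=> [[]|] ->; rewrite eqxx ?orbT.
Qed.

Lemma big_centers (V : zmodType) (h : R * R -> V) :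
  \sum_(p <- centers) h p = h q1 + h q2 + h q3 + h q4 + h c.
Proof. by rewrite !big_cons big_nil addr0 !addrA. Qed.

Lemma le_sum_centers (V : R * R -> R) p : p \in centers ->
  (forall q, q \in centers -> 0 <= V q) -> V p <= \sum_(q <- centers) V q.
Proof.
move=> pc V0; have cP q := introT (mem_centersP q); rewrite big_centers.
have v1 := V0 _ (cP _ (or_introl (Or41 _ _ _ erefl))).
have v2 := V0 _ (cP _ (or_introl (Or42 _ _ _ erefl))).
have v3 := V0 _ (cP _ (or_introl (Or43 _ _ _ erefl))).
have v4 := V0 _ (cP _ (or_introl (Or44 _ _ _ erefl))).
have v5 := V0 _ (cP _ (or_intror erefl)).
by case/mem_centersP: pc => [[]|] ->; lra.
Qed.

Lemma centers_bounds p : p \in centers ->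
  (0 <= p.1 <= 1) && (0 <= p.2 <= 1).
Proof. by move/mem_centersP => [[]|] ->; rewrite /=; lra. Qed.

Lemma vicsek_map_inj p : injective (F p).
Proof.
move=> [x1 x2] [y1 y2]; rewrite !vicsek_mapE /= => -[h1 h2].
by congr pair; lra.
Qed.

Definition vicsek_unmap p x : R * R := (3 * (x.1 - p.1) + p.1, 3 * (x.2 - p.2) + p.2).

Lemma vicsek_mapK p : cancel (F p) (vicsek_unmap p).
Proof. by case=> x1 x2; rewrite vicsek_mapE /vicsek_unmap /=; congr pair; lra. Qed.

Lemma vicsek_unmapK p : cancel (vicsek_unmap p) (F p).
Proof. by case=> x1 x2; rewrite vicsek_mapE /vicsek_unmap /=; congr pair; lra. Qed.

Lemma vicsek_map_fix p : F p p = p.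
Proof. by case: p => a b; rewrite vicsek_mapE /=; congr pair; lra. Qed.

Lemma vicsek_junctions : [/\ F q1 q3 = F c q1, F q2 q4 = F c q2, F q3 q1 = F c q3
  & F q4 q2 = F c q4].
Proof. by rewrite !vicsek_mapE /=; split; congr pair; lra. Qed.

Definition reflection b x : R * R := if b then (1 - x.1, x.2) else (x.1, 1 - x.2).

Lemma reflectionK b : involutive (reflection b).
Proof. by case: b => -[x1 x2]; rewrite /reflection /=; congr pair; lra. Qed.

Lemma reflection_map b p x :
  reflection b (F p x) = F (reflection b p) (reflection b x).
Proof. by case: b; rewrite /reflection !vicsek_mapE /=; congr pair; lra. Qed.

Lemma reflection_centers b p : p \in centers -> reflection b p \in centers.
Proof.
have cE : (1 - 2^-1 : R) = 2^-1 by lra.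
move/mem_centersP => h; apply/mem_centersP; move: h.
by case: b => -[[]|] ->; rewrite /reflection /vq1 /vq2 /vq3 /vq4 /vc /= ?subrr ?subr0 ?cE;
  solve [right; reflexivity | left; constructor 1; reflexivity
        | left; constructor 2; reflexivity | left; constructor 3; reflexivity
        | left; constructor 4; reflexivity].
Qed.

Definition coord b x : R := if b then x.1 else x.2.

Definition close (e : R) x y := (`|x.1 - y.1| < e) && (`|x.2 - y.2| < e).

Lemma close_map e p x y : close e (F p x) (F p y) = close (3 * e) x y.
Proof.
have h (s t a : R) :
    (`|3^-1 * (s - a) + a - (3^-1 * (t - a) + a)| < e) = (`|s - t| < 3 * e).
  have -> : 3^-1 * (s - a) + a - (3^-1 * (t - a) + a) = 3^-1 * (s - t) by lra.
  by rewrite normrM gtr0_norm ?invr_gt0 ?ltr0n// ltr_pdivrMl.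
by rewrite /close !vicsek_mapE /= !h.
Qed.

Lemma close_reflection e b x y :
  close e (reflection b x) (reflection b y) = close e x y.
Proof.
have h (s t : R) : `|1 - s - (1 - t)| = `|s - t|.
  by rewrite -normrN; congr (`|_|); lra.
by case: b; rewrite /close /reflection /= !h.
Qed.

Lemma closeW e e' x y : e <= e' -> close e x y -> close e' x y.
Proof. by move=> ee /andP[h1 h2]; rewrite /close !(lt_le_trans _ ee). Qed.

Lemma close_nbhs x (U : set (R * R)) :
  nbhs x U <-> exists2 e : R, 0 < e & forall y, close e x y -> U y.
Proof.
split.
  move=> /nbhs_ballP[e /= e0 h]; exists e => // y /andP[h1 h2].
  by apply: h; split; rewrite /ball /=.
move=> [e e0 h]; apply/nbhs_ballP; exists e => //= y [h1 h2].
by apply: h; apply/andP; split.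
Qed.

Lemma exp3_small (B e : R) : 0 < e -> exists n, B / 3 ^+ n < e.
Proof.
move=> e0; have [/= n hn] : exists n : nat, `|B| / e < n%:R.
  by exists (Num.truncn (`|B| / e)).+1; exact: truncnS_gt.
exists n; rewrite ltr_pdivrMr ?exprn_gt0//.
apply: (le_lt_trans (ler_norm B)).
rewrite mulrC -ltr_pdivrMr// (lt_le_trans hn)//.
by rewrite -natrX ler_nat ltnW// ltn_expl.
Qed.

Lemma exp35_small (B e : R) : 0 < e -> exists n, B * (3 / 5) ^+ n < e.
Proof.
(* Since [(3 / 5) ^+ 4 <= 1 / 3], four factors [3 / 5] beat one factor [1 / 3]. *)
move=> e0; have [n hn] := exp3_small `|B| e0; exists (4 * n)%N.
apply: le_lt_trans hn; apply: (@le_trans _ _ (`|B| * (3 / 5) ^+ (4 * n))).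
  by rewrite ler_wpM2r ?ler_norm// exprn_ge0//; lra.
rewrite ler_wpM2l// exprM -exprVn lerXn2r ?nnegrE ?exprn_ge0 ?invr_ge0//; lra.
Qed.

End Geometry.

(** * Consequences of self-similarity for the compact set [K] *)

Section VicsekSet.
Variables (R : realType) (K : set (R * R)) (hK : is_vicsek_set K).
Implicit Types (p x y : R * R) (b : bool).
Local Notation F := (@vicsek_map R).
Local Notation centers := (vicsek_centers R).

Lemma K_map p x : p \in centers -> K x -> K (F p x).
Proof.
by move=> pc Kx; have [_ _ ->] := hK; exists p => //=; exists x.
Qed.

Lemma K_case x : K x ->
  exists2 p, p \in centers & exists2 y, K y & x = F p y.
Proof.
have [_ _ {1}->] := hK; move=> [p /= pc [y Ky <-]].
by exists p => //; exists y.
Qed.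

Lemma K_closed : closed K.
Proof.
by have [_ cK _] := hK; apply: compact_closed => //; exact: norm_hausdorff.
Qed.

Lemma K_limit x : (forall e : R, 0 < e -> exists2 y, K y & close e x y) -> K x.
Proof.
move=> h; apply: K_closed => U /close_nbhs[e e0 hU].
by have [y Ky xy] := h _ e0; exists y; split => //; exact: hU.
Qed.

Lemma K_not_limit x : ~ K x ->
  exists2 e : R, 0 < e & forall y, K y -> ~ close e x y.
Proof.
move=> nKx; apply: contrapT => h; apply: nKx; apply: K_limit => e e0.
apply: contrapT => h'; apply: h; exists e => // y Ky xy; apply: h'.
by exists y.
Qed.

Lemma K_bounded : exists2 B : R, 0 <= B & forall x, K x -> `|x.1| <= B /\ `|x.2| <= B.
Proof.
have [_ cK _] := hK.
have /ex_strict_bound_gt0[B B0 hB] := compact_bounded cK.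
exists B => [|x Kx]; first exact: ltW.
by have /ltW := hB _ Kx; rewrite prod_normE ge_max => /andP[].
Qed.

(** The maps preserve the unit square and shrink any excess beyond it by 3, so an a priori bound [B]
    improves to [B / 3 ^+ n] for every [n]. *)
Lemma K_box x : K x -> (0 <= x.1 <= 1) && (0 <= x.2 <= 1).
Proof.
have [B B0 hB] := K_bounded.
suff h n y : K y -> [/\ - (B / 3 ^+ n) <= y.1, y.1 <= 1 + B / 3 ^+ n,
    - (B / 3 ^+ n) <= y.2 & y.2 <= 1 + B / 3 ^+ n].
  have h' e : 0 < e -> K x -> [/\ - e <= x.1, x.1 <= 1 + e, - e <= x.2 & x.2 <= 1 + e].
    by move=> e0 Kx; have [n hn] := exp3_small B e0; have [] := h n _ Kx; split; lra.
  move=> Kx; apply/andP; split; apply/andP; split;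
    by apply/ler_addgt0Pr => e e0; have [] := h' e e0 Kx; lra.
elim: n y => [|n IH] y Ky.
  have [] := hB _ Ky; rewrite !ler_norml !expr0 divr1.
  by move=> /andP[? ?] /andP[? ?]; split; lra.
have [p /centers_bounds pc [z /IH[h1 h2 h3 h4] ->]] := K_case Ky.
rewrite vicsek_mapE /= exprS invfM.
move: pc h1 h2 h3 h4; set t := (3 ^+ n)^-1 => pc h1 h2 h3 h4.
by split; nra.
Qed.

Lemma K_fix p : p \in centers -> K p.
Proof.
move=> pc; have [[x Kx] _ _] := hK; apply: K_limit => e e0.
have [n hn] := @exp3_small _ 2 _ e0.
suff [y Ky hy] : exists2 y, K y & close (2 / 3 ^+ n) p y.
  by exists y => //; apply: closeW hy; exact: ltW.
elim: n {hn} => [|n [y Ky hy]].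
  exists x => //; have := K_box Kx; have := centers_bounds pc.
  rewrite /close expr0 divr1 !ltr_norml.
  by move=> /andP[/andP[? ?] /andP[? ?]] /andP[/andP[? ?] /andP[? ?]]; lra.
exists (F p y); first exact: K_map.
rewrite -{1}(vicsek_map_fix p) close_map.
by apply: closeW hy; rewrite exprS invfM; lra.
Qed.

(** A reflection permutes the five maps. Reflecting the first [n] centres in an address of [x]
    yields a point of [K] at distance of order [3 ^- n] from the mirror image, and [K] is closed. *)
Lemma K_reflection b x : K x -> K (reflection b x).
Proof.
move=> Kx; apply: K_limit => e e0.
have [n hn] := @exp3_small _ 2 _ e0.
suff [y Ky hy] : exists2 y, K y & close (2 / 3 ^+ n) (reflection b x) y.
  by exists y => //; apply: closeW hy; exact: ltW.
elim: n {hn} x Kx => [|n IH] x Kx.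
  exists x => //; have := K_box Kx; rewrite /close /reflection expr0 divr1 !ltr_norml.
  by case: b => /andP[/andP[? ?] /andP[? ?]] /=; lra.
have [p pc [z Kz ->]] := K_case Kx; have [y Ky hy] := IH _ Kz.
exists (F (reflection b p) y); first exact/K_map/Ky/reflection_centers.
by rewrite reflection_map close_map; apply: closeW hy; rewrite exprS invfM; lra.
Qed.

(* A point of K off the central cell is at distance at least 1/6 from the line
   x = 1/2, and K is self-similar about its centre. *)
Lemma K_cone b x : K x -> `|coord (~~ b) x - 2^-1| <= 3 * `|coord b x - 2^-1|.
Proof.
move=> Kx; apply/ler_addgt0Pr => e e0.
have [n hn] := @exp3_small _ 1 _ e0.
suff : `|coord (~~ b) x - 2^-1| <= 3 * `|coord b x - 2^-1| + 1 / 3 ^+ n by lra.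
elim: n {hn} x Kx => [|n IH] x Kx.
  have := K_box Kx; rewrite expr0 divr1 => h.
  apply: (@le_trans _ _ 1); last by rewrite lerDr mulr_ge0.
  by rewrite ler_norml; move: h; case: b => /=; lra.
have [p pc [z Kz xE]] := K_case Kx.
have [pE|np] := eqVneq p (vc R).
  have h b' : coord b' x - 2^-1 = 3^-1 * (coord b' z - 2^-1).
    by rewrite xE pE vicsek_mapE /coord; case: b' => /=; lra.
  rewrite !h !normrM (@gtr0_norm _ (3^-1)) ?invr_gt0 ?ltr0n//.
  by have := IH _ Kz; rewrite exprS invfM; lra.
have t0 : 0 <= 1 / 3 ^+ n.+1 :> R by rewrite divr_ge0// exprn_ge0.
suff : `|coord (~~ b) x - 2^-1| <= 2^-1 /\ 6^-1 <= `|coord b x - 2^-1|.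
  by case; lra.
split; first by rewrite ler_norml; have := K_box Kx; case: (b) => /=; lra.
rewrite ler_normr xE vicsek_mapE.
have := K_box Kz; move/mem_centersP: pc => [[]|] pE; move: np;
  rewrite pE ?eqxx//= => _; case: (b); rewrite /coord /=; lra.
Qed.

(** For each of the five maps, the preimage of [x] either lies in [K] or has positive distance from
    [K], and then nearby points avoid that cell. The radius [dl] may depend on the cell and on the
    preimage, so that local estimates on cells can be transferred to [K]. *)
Lemma local_cell x (dl : R * R -> R * R -> R) : K x ->
  (forall p y, 0 < dl p y) ->
  exists2 d : R, 0 < d & forall y, K y -> close d x y ->
    exists2 p, p \in centers & exists x' y',
      [/\ K x', K y', x = F p x', y = F p y' & close (dl p x') x' y'].
Proof.
move=> Kx dl0.
have h p : exists2 d : R, 0 < d & forall y, K y -> close d x (F p y) ->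
    exists2 x', K x' /\ x = F p x' & close (dl p x') x' y.
  have [Kx'|nKx'] := pselect (K (vicsek_unmap p x)).
    exists (dl p (vicsek_unmap p x) / 3) => [|y Ky]; first by rewrite divr_gt0.
    rewrite -[X in close _ X](vicsek_unmapK p x) close_map mulrCA mulfV ?pnatr_eq0// mulr1.
    by exists (vicsek_unmap p x) => //; rewrite vicsek_unmapK.
  have [e e0 he] := K_not_limit nKx'.
  exists (e / 3) => [|y Ky]; first by rewrite divr_gt0.
  rewrite -[X in close _ X](vicsek_unmapK p x) close_map mulrCA mulfV ?pnatr_eq0// mulr1.
  by move/he => /(_ Ky).
have {h} : exists2 d : R, 0 < d & forall p, p \in centers -> forall y, K y ->
    close d x (F p y) -> exists2 x', K x' /\ x = F p x' & close (dl p x') x' y.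
  elim: (vicsek_centers R) => [|p s [d d0 hd]]; first by exists 1.
  have [d' d'0 hd'] := h p.
  exists (Num.min d d') => [|p']; first by rewrite lt_min d0 d'0.
  rewrite inE => /orP[/eqP->|ps] y Ky xy.
    by apply: hd' => //; apply: closeW xy; rewrite ge_min lexx orbT.
  by apply: hd => //; apply: closeW xy; rewrite ge_min lexx.
move=> [d d0 hd]; exists d => // y Ky.
have [p pc [y' Ky' ->]] := K_case Ky.
move=> /hd-/(_ pc Ky')[x' [Kx' xE] xy].
by exists p => //; exists x', y'.
Qed.

End VicsekSet.

(** * Renormalized graph energies, computed cell by cell *)

Section Energy.
Variable R : realType.
Implicit Types (p x y : R * R) (b : bool) (f g : R * R -> R).
Local Notation F := (@vicsek_map R).
Local Notation centers := (vicsek_centers R).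

Definition increment2 f g x y : R := (f x - f y) * (g x - g y).

Definition corner_form f g : R :=
  increment2 f g (vq1 R) (vq2 R) + increment2 f g (vq1 R) (vq3 R) +
  increment2 f g (vq1 R) (vq4 R) + increment2 f g (vq2 R) (vq3 R) +
  increment2 f g (vq2 R) (vq4 R) + increment2 f g (vq3 R) (vq4 R).

(** The polarized form of [3 ^+ m * graph_energy m], as [graph_energyE] confirms. Recursion by
    composition with the maps replaces edge sets by a statement about one cell at a time. *)
Fixpoint En (m : nat) f g : R :=
  if m is n.+1 then 3 * \sum_(p <- centers) En n (f \o F p) (g \o F p)
  else corner_form f g.

Lemma EnC m f g : En m f g = En m g f.
Proof.
elim: m f g => [|m IH] f g /=; last by under eq_bigr do rewrite IH.
by rewrite /corner_form /increment2; ring.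
Qed.

Lemma En_reflection m b f g :
  En m (f \o reflection b) (g \o reflection b) = En m f g.
Proof.
elim: m f g => [|m IH] f g /=.
  case: b; rewrite /corner_form /increment2 /reflection /vq1 /vq2 /vq3 /vq4 /=;
    rewrite ?subr0 ?subrr; ring.
have E p h : (h \o reflection b) \o F p = (h \o F (reflection b p)) \o reflection b.
  by apply/funext => x /=; rewrite reflection_map.
under eq_bigr do rewrite !E IH.
rewrite !big_centers; congr (_ * _).
have cE : (1 - 2^-1 : R) = 2^-1 by lra.
by case: b {IH E}; rewrite /reflection /vq1 /vq2 /vq3 /vq4 /vc /= ?subr0 ?subrr ?cE; ring.
Qed.

(* With a_i, b_i the values of f at q_i and at the vertex of the central cell
   nearest to it, the cell at q_i contributes at least 2 (a_i - b_i)^2, and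
   (s + t)^2 <= 3 s^2 + 3/2 t^2. *)
Lemma corner_form_mono f : corner_form f f <= En 1 f f.
Proof.
rewrite /= big_centers /corner_form /increment2 /= !vicsek_mapE /vq1 /vq2 /vq3 /vq4 /vc /=.
have E1 : 3^-1 * (0 - 0) + 0 = 0 :> R by lra.
have E2 : 3^-1 * (1 - 1) + 1 = 1 :> R by lra.
have E3 : 3^-1 * (0 - 2^-1) + 2^-1 = 3^-1 :> R by lra.
have E4 : 3^-1 * (1 - 2^-1) + 2^-1 = 2 / 3 :> R by lra.
have E5 : 3^-1 * (1 - 0) + 0 = 3^-1 :> R by lra.
have E6 : 3^-1 * (0 - 1) + 1 = 2 / 3 :> R by lra.
rewrite !E1 !E2 !E3 !E4 !E5 !E6.
have K4 (a b s t : R) : 2 * (a - b) ^+ 2 <=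
    (a - b) ^+ 2 + (a - s) ^+ 2 + (a - t) ^+ 2 + (b - s) ^+ 2 + (b - t) ^+ 2 + (s - t) ^+ 2.
  have h1 : 0 <= (a + b - 2 * s) ^+ 2 by exact: sqr_ge0.
  have h2 : 0 <= (a + b - 2 * t) ^+ 2 by exact: sqr_ge0.
  have h3 : 0 <= (s - t) ^+ 2 by exact: sqr_ge0.
  by nra.
set a1 := f (0, 1); set a2 := f (1, 1); set a3 := f (1, 0); set a4 := f (0, 0).
set b1 := f (3^-1, 2 / 3); set b2 := f (2 / 3, 2 / 3).
set b3 := f (2 / 3, 3^-1); set b4 := f (3^-1, 3^-1).
set s1 := f (3^-1, 1); set t1 := f (0, 2 / 3); set s2 := f (2 / 3, 1).
set t2 := f (1, 2 / 3); set s3 := f (2 / 3, 0); set t3 := f (1, 3^-1).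
set s4 := f (3^-1, 0); set t4 := f (0, 3^-1).
have S (s t : R) : (s + t) ^+ 2 <= 3 * s ^+ 2 + 3 / 2 * t ^+ 2.
  have h1 : 0 <= (2 * s - t) ^+ 2 by exact: sqr_ge0.
  by nra.
have k1 := K4 a1 b1 s1 t1.
have k2 := K4 a2 b2 s2 t2.
have k3 := K4 a3 b3 s3 t3.
have k4 := K4 a4 b4 s4 t4.
have s12 := S (b1 - b2) (a1 - b1 - (a2 - b2)).
have s13 := S (b1 - b3) (a1 - b1 - (a3 - b3)).
have s14 := S (b1 - b4) (a1 - b1 - (a4 - b4)).
have s23 := S (b2 - b3) (a2 - b2 - (a3 - b3)).
have s24 := S (b2 - b4) (a2 - b2 - (a4 - b4)).
have s34 := S (b3 - b4) (a3 - b3 - (a4 - b4)).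
(* With [c_i = a_i - b_i], the squares [(c_i - c_j) ^+ 2] over all pairs add up to
   [4 * sum c_i ^+ 2 - (sum c_i) ^+ 2]. Dropping the last square leaves the factor
   [3 / 2 * 4 = 3 * 2], exactly what the corner cells provide. *)
have d : 0 <= (a1 - b1 + (a2 - b2) + (a3 - b3) + (a4 - b4)) ^+ 2 by exact: sqr_ge0.
clear K4 S; clearbody a1 a2 a3 a4 b1 b2 b3 b4 s1 t1 s2 t2 s3 t3 s4 t4.
lra.
Qed.

Lemma En_mono m f : En m f f <= En m.+1 f f.
Proof.
elim: m f => [|m IH] f; first exact: corner_form_mono.
by rewrite [leRHS]/= [leLHS]/= ler_pM2l// ler_sum// => p _; exact: IH.
Qed.

Lemma En_nondecreasing f : nondecreasing_seq (fun m => En m f f).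
Proof. by apply/nondecreasing_seqP => m; exact: En_mono. Qed.

Lemma En_ge0 m f : 0 <= En m f f.
Proof.
elim: m f => [|m IH] f /=; last by rewrite mulr_ge0// sumr_ge0.
by rewrite /corner_form /increment2 -!expr2 !addr_ge0 ?sqr_ge0.
Qed.

End Energy.

(** * The domain of the energy and the limit form [EF] *)

Section EnergyK.
Variables (R : realType) (K : set (R * R)) (hK : is_vicsek_set K).
Implicit Types (p x y : R * R) (b : bool) (f g : R * R -> R).
Local Notation F := (@vicsek_map R).
Local Notation centers := (vicsek_centers R).

Lemma vq_K : [/\ K (vq1 R), K (vq2 R), K (vq3 R), K (vq4 R) & K (vc R)].
Proof.
by split; apply: (K_fix hK); apply/mem_centersP; [left; constructor 1|
  left; constructor 2|left; constructor 3|left; constructor 4|right].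
Qed.

Lemma En_lin m (a b : R) f f1 f2 g : (forall x, K x -> f x = a * f1 x + b * f2 x) ->
  En m f g = a * En m f1 g + b * En m f2 g.
Proof.
elim: m f f1 f2 g => [|m IH] f f1 f2 g h /=.
  have [K1 K2 K3 K4 _] := vq_K.
  by rewrite /corner_form /increment2 !h//; ring.
rewrite [a * _]mulrCA [b * _]mulrCA -mulrDr; congr (_ * _).
rewrite !mulr_sumr -big_split /=; rewrite !big_seq; apply: eq_bigr => p pc.
by apply: IH => x Kx; apply: h; exact: K_map.
Qed.

Lemma En_eql m f f' g : (forall x, K x -> f x = f' x) -> En m f g = En m f' g.
Proof.
move=> h; rewrite (@En_lin m 1 0 f f' f')// ?mul0r ?addr0 ?mul1r// => x Kx.
by rewrite mul1r mul0r addr0 h.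
Qed.

Lemma En_eq m f f' g g' : (forall x, K x -> f x = f' x) ->
  (forall x, K x -> g x = g' x) -> En m f g = En m f' g'.
Proof. by move=> h h'; rewrite (En_eql _ _ h) EnC (En_eql _ _ h') EnC. Qed.

(** The form is a positive combination of increments along edges of level [m], whose ends differ by
    at most [3 ^- m] in each coordinate; the factor 2 makes room for the strict inequality in
    [close]. *)
Lemma En_le m f g f' g' :
  (forall x y, K x -> K y -> close (2 / 3 ^+ m) x y ->
    increment2 f g x y <= increment2 f' g' x y) ->
  En m f g <= En m f' g'.
Proof.
elim: m f g f' g' => [|m IH] f g f' g' h /=.
  have [K1 K2 K3 K4 _] := vq_K.
  have c2 (s t : R) : 0 <= s <= 1 -> 0 <= t <= 1 -> `|s - t| < 2 / 3 ^+ 0.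
    by move=> ? ?; rewrite expr0 divr1 ltr_norml; lra.
  by rewrite /corner_form !lerD// h// /close !c2//= ?lexx ?ler01.
rewrite ler_pM2l// !big_seq ler_sum// => p pc.
apply: IH => x y Kx Ky xy; apply: h; [exact: K_map|exact: K_map|].
by rewrite close_map; apply: closeW xy; rewrite exprS invfM; lra.
Qed.

Definition Kcont f := forall x, K x -> forall e, 0 < e ->
  exists2 d : R, 0 < d & forall y, K y -> close d x y -> `|f x - f y| < e.

Lemma KcontP f : {within K, continuous f} <-> Kcont f.
Proof.
split.
  move=> /subspace_continuousP h x Kx e e0.
  have /cvgrPdist_lt/(_ _ e0) := h x Kx.
  move=> /close_nbhs[d d0 hd]; exists d => // y Ky xy.
  by exact: hd.
move=> h; apply/subspace_continuousP => x Kx; apply/cvgrPdist_lt => e e0.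
have [d d0 hd] := h x Kx e e0.
by apply/close_nbhs; exists d => // y xy Ky; exact: hd.
Qed.

Lemma Kcont_cvg f : Kcont f <-> forall x, K x -> f y @[y --> within K (nbhs x)] --> f x.
Proof. by split=> [/KcontP/subspace_continuousP//|h]; apply/KcontP/subspace_continuousP. Qed.

Lemma KcontD f g : Kcont f -> Kcont g -> Kcont (fun x => f x + g x).
Proof.
move=> /Kcont_cvg hf /Kcont_cvg hg; apply/Kcont_cvg => x Kx.
by apply: cvgD; [exact: hf|exact: hg].
Qed.

Lemma KcontM f g : Kcont f -> Kcont g -> Kcont (fun x => f x * g x).
Proof.
move=> /Kcont_cvg hf /Kcont_cvg hg; apply/Kcont_cvg => x Kx.
by apply: cvgM; [exact: hf|exact: hg].
Qed.

Lemma Kcont_cst (a : R) : Kcont (fun=> a).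
Proof. by move=> x Kx e e0; exists 1 => // y _ _; rewrite subrr normr0. Qed.

Lemma Kcont_lip (C : R) f g :
  (forall x y, K x -> K y -> `|g x - g y| <= C * `|f x - f y|) ->
  Kcont f -> Kcont g.
Proof.
move=> h hf x Kx e e0; have C0 : 0 < `|C| + 1 by rewrite ltr_wpDl.
have [d d0 hd] := hf x Kx (e / (`|C| + 1)) (divr_gt0 e0 C0).
exists d => // y Ky xy; apply: (le_lt_trans (h _ _ Kx Ky)).
have := hd y Ky xy; rewrite ltr_pdivlMr//.
by have := ler_norm C; have := normr_ge0 (f x - f y); nra.
Qed.

Lemma Kcont_map p f : p \in centers -> Kcont f -> Kcont (f \o F p).
Proof.
move=> pc hf x Kx e e0; have [d d0 hd] := hf _ (K_map hK pc Kx) e e0.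
exists d => // y Ky xy; apply: hd; first exact: K_map.
by rewrite close_map; apply: closeW xy; lra.
Qed.

Lemma Kcont_reflection b f : Kcont f -> Kcont (f \o reflection b).
Proof.
move=> hf x Kx e e0; have [d d0 hd] := hf _ (K_reflection hK b Kx) e e0.
exists d => // y Ky xy; apply: hd; first exact: K_reflection.
by rewrite close_reflection.
Qed.

Lemma Kcont_cells f : (forall p, p \in centers -> Kcont (f \o F p)) -> Kcont f.
Proof.
move=> h x Kx e e0.
have /choice[dl hdl] : forall z : (R * R) * (R * R), exists d : R, 0 < d /\
    (z.1 \in centers -> K z.2 -> forall y, K y -> close d z.2 y ->
      `|f (F z.1 z.2) - f (F z.1 y)| < e).
  move=> [p z] /=.
  have [pc|npc] := boolP (p \in centers); last by exists 1; split.
  have [Kz|nKz] := pselect (K z); last by exists 1; split.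
  by have [d d0 hd] := h p pc z Kz e e0; exists d.
have [d d0 hd] := local_cell hK Kx (fun p y => (hdl (p, y)).1).
exists d => // y Ky /(hd y Ky)[p pc [x' [y' [Kx' Ky' -> -> xy]]]].
exact: (hdl (p, x')).2.
Qed.

Lemma En_sqrD m (a b : R) f g h : (forall x, K x -> h x = a * f x + b * g x) ->
  En m h h = a ^+ 2 * En m f f + 2 * a * b * En m f g + b ^+ 2 * En m g g.
Proof.
move=> hE; rewrite (En_lin m h hE) (EnC m f) (EnC m g) !(En_lin m _ hE) (EnC m g f).
ring.
Qed.

Definition dom f := Kcont f /\ exists B : R, forall m, En m f f <= B.

Definition EF f g : R := limn (fun m => En m f g).

Lemma domD f g : dom f -> dom g -> dom (fun x => f x + g x).
Proof.
move=> [fc [B hB]] [gc [B' hB']]; split; first exact: KcontD.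
exists (2 * B + 2 * B') => m.
have E : forall x, K x -> f x + g x = 1 * f x + 1 * g x by move=> x _; rewrite !mul1r.
have E' : forall x, K x -> f x - g x = 1 * f x + (-1) * g x.
  by move=> x _; rewrite mul1r mulN1r.
have := En_ge0 m (fun x => f x - g x); rewrite (En_sqrD m E) (En_sqrD m E').
by have := hB m; have := hB' m; lra.
Qed.

(** The contraction property of the energy, which keeps positive parts, thresholds and multiples in
    the domain. *)
Lemma dom_lip (C : R) f g :
  (forall x y, K x -> K y -> `|g x - g y| <= C * `|f x - f y|) ->
  dom f -> dom g.
Proof.
move=> h [fc [B hB]]; split; first exact: Kcont_lip h fc.
exists (C ^+ 2 * B) => m; apply: le_trans (ler_wpM2l (sqr_ge0 C) (hB m)).
have -> : C ^+ 2 * En m f f = En m (fun x => C * f x) (fun x => C * f x).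
  have E k : En m (fun x => C * f x) k = C * En m f k.
    by rewrite (@En_lin m C 0 _ f f) ?mul0r ?addr0// => x _; rewrite mul0r addr0.
  by rewrite E EnC E expr2 mulrA.
apply: En_le => x y Kx Ky _; rewrite /increment2 -mulrBr -!expr2 -[leLHS]real_normK ?num_real//.
rewrite -[leRHS]real_normK ?num_real// lerXn2r ?nnegrE// normrM.
by apply: (le_trans (h _ _ Kx Ky)); rewrite ler_wpM2r// ler_norm.
Qed.

Lemma dom_eq f g : (forall x, K x -> f x = g x) -> dom f -> dom g.
Proof. by move=> h; apply: (@dom_lip 1) => x y Kx Ky; rewrite mul1r !h. Qed.

Lemma domZ a f : dom f -> dom (fun x => a * f x).
Proof. by apply: (@dom_lip `|a|) => x y _ _; rewrite -mulrBr normrM. Qed.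

Lemma dom_lin (a b : R) f g : dom f -> dom g -> dom (fun x => a * f x + b * g x).
Proof. by move=> /(domZ a) ? /(domZ b) ?; exact: domD. Qed.

Lemma dom_cst a : dom (fun=> a).
Proof.
split; first exact: Kcont_cst.
exists 0 => m; elim: m => [|m IH] /=.
  by rewrite /corner_form /increment2 !subrr !mul0r !addr0.
by rewrite pmulr_rle0// big_seq; apply: sumr_le0 => p _; exact: IH.
Qed.

Lemma dom_reflection b f : dom f -> dom (f \o reflection b).
Proof.
move=> [fc [B hB]]; split; first exact: Kcont_reflection.
by exists B => m; rewrite En_reflection.
Qed.

Lemma dom_map p f : p \in centers -> dom f -> dom (f \o F p).
Proof.
move=> pc [fc [B hB]]; split; first exact: Kcont_map.
exists (B / 3) => m; rewrite ler_pdivlMr// mulrC; apply: le_trans (hB m.+1).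
rewrite /= ler_pM2l//.
by apply: (@le_sum_centers _ (fun q => En m (f \o F q) (f \o F q))) => // q _; exact: En_ge0.
Qed.

Lemma dom_cells f : (forall p, p \in centers -> dom (f \o F p)) -> dom f.
Proof.
move=> h; split; first by apply: Kcont_cells => p /h[].
have /choice[B hB] : forall p, exists B : R, p \in centers ->
    forall m, En m (f \o F p) (f \o F p) <= B.
  move=> p; have [/h[_ [B hB]]|npc] := boolP (p \in centers); first by exists B.
  by exists 0.
exists (3 * \sum_(p <- centers) B p) => m; apply: (le_trans (En_mono m f)).
rewrite /= ler_pM2l// !big_seq ler_sum// => p pc; exact: hB.
Qed.

(** The mixed energies need not be monotone in [m]; polarization writes them through the energies of
    [f + g] and [f - g], which are monotone and bounded. *)
Lemma EF_cvg f g : dom f -> dom g -> En m f g @[m --> \oo] --> EF f g.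
Proof.
have C h : dom h -> cvgn (fun m => En m h h).
  move=> [_ [B hB]]; apply: nondecreasing_is_cvgn; first exact: En_nondecreasing.
  by exists B => _ [m _ <-].
move=> df dg; apply/(@cvg_ex R^o).
pose s := fun x => f x + g x; pose d := fun x => f x + (-1) * g x.
have cs := C _ (domD df dg : dom s).
have cd := C _ (domD df (domZ (-1) dg) : dom d).
exists (4^-1 * (limn (fun m => En m s s) - limn (fun m => En m d d))).
have -> : (fun m => En m f g) = (fun m => 4^-1 * (En m s s - En m d d)).
  apply/funext => m.
  have E x : K x -> s x = 1 * f x + 1 * g x by rewrite /s !mul1r.
  have E' x : K x -> d x = 1 * f x + (-1) * g x by rewrite /d mul1r.
  by rewrite (En_sqrD m E) (En_sqrD m E'); lra.
by apply: cvgMr; apply: cvgB.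
Qed.

Lemma EFC f g : EF f g = EF g f.
Proof. by rewrite /EF; under eq_fun do rewrite EnC. Qed.

Lemma EF_lin (a b : R) f f1 f2 g : dom f1 -> dom f2 -> dom g ->
  (forall x, K x -> f x = a * f1 x + b * f2 x) ->
  EF f g = a * EF f1 g + b * EF f2 g.
Proof.
move=> d1 d2 dg h; apply/cvg_lim => //.
under eq_fun do rewrite (En_lin _ _ h).
by apply: cvgD; apply: cvgMr; exact: EF_cvg.
Qed.

Lemma EF_eq f f' g g' : (forall x, K x -> f x = f' x) ->
  (forall x, K x -> g x = g' x) -> EF f g = EF f' g'.
Proof. by move=> h h'; rewrite /EF; under eq_fun do rewrite (En_eq _ h h'). Qed.

(* Only pairs of neighbours of fine graphs are compared, so the hypothesis is
   needed for close pairs only. *)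
Lemma EF_le (d : R) f g f' g' : 0 < d -> dom f -> dom g -> dom f' -> dom g' ->
  (forall x y, K x -> K y -> close d x y -> increment2 f g x y <= increment2 f' g' x y) ->
  EF f g <= EF f' g'.
Proof.
move=> d0 df dg df' dg' h.
have [n hn] := @exp3_small R 2 _ d0.
apply: ler_cvg_to (EF_cvg df dg) (EF_cvg df' dg') _.
exists n => // m /= nm; apply: En_le => x y Kx Ky xy; apply: h => //.
apply: closeW xy; apply: le_trans (ltW hn).
by rewrite ler_pM2l// lef_pV2 ?posrE ?exprn_gt0// ler_eXn2l// ltr1n.
Qed.

Lemma En_le_EF m f : dom f -> En m f f <= EF f f.
Proof.
move=> df; apply: nondecreasing_cvgn_le; first exact: En_nondecreasing.
by apply/cvg_ex; exists (EF f f); exact: EF_cvg.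
Qed.

Lemma EF_ge0 f : dom f -> 0 <= EF f f.
Proof. by move=> df; apply: le_trans (En_le_EF 0 df); exact: En_ge0. Qed.

Lemma EF_reflection b f g : EF (f \o reflection b) (g \o reflection b) = EF f g.
Proof. by rewrite /EF; under eq_fun do rewrite En_reflection. Qed.

Lemma EF_cells f g : dom f -> dom g ->
  EF f g = 3 * \sum_(p <- centers) EF (f \o F p) (g \o F p).
Proof.
move=> df dg; apply/cvg_lim => //.
rewrite -(cvg_shiftS (fun m => En m f g)) /=.
apply: cvgMr; rewrite big_seq; under eq_fun do rewrite big_seq.
apply: cvg_big => [|p pc]; first exact: add_continuous.
by apply: EF_cvg; exact: dom_map.
Qed.

Lemma EF_cst a g : EF (fun=> a) g = 0.
Proof.
rewrite /EF (_ : (fun m => _) = fun=> 0) ?lim_cst//; apply/funext => m.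
elim: m g => [|m IH] g /=.
  by rewrite /corner_form /increment2 subrr !mul0r !addr0.
by rewrite big1 ?mulr0// => p _; exact: IH.
Qed.

End EnergyK.

(** * Edge sets of the graphs and the recursion for their energy *)

Lemma big_bigfcup_disjoint (V : nmodType) (I : eqType) (T : choiceType)
    (s : seq I) (G : I -> {fset T}) (h : T -> V) : uniq s ->
  (forall i j t, i \in s -> j \in s -> t \in G i -> t \in G j -> i = j) ->
  \sum_(t <- (\bigcup_(i <- s) G i)%fset) h t = \sum_(i <- s) \sum_(t <- G i) h t.
Proof.
elim: s => [|a s IH] us hd; first by rewrite !big_nil.
move: us; rewrite /= => /andP[nas us].
rewrite [in RHS]big_cons -IH//; last first.
  by move=> i j t si sj; apply: hd; rewrite inE ?si ?sj orbT.
rewrite -big_cat; apply: perm_big; apply: uniq_perm => //.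
  rewrite cat_uniq !fset_uniq /= andbT; apply/hasPn => t.
  move=> /bigfcupP[i]; rewrite andbT => si ti; apply/negP => ta.
  by move: nas; rewrite -(hd i a t) ?si// inE ?si ?eqxx ?orbT.
by move=> t; rewrite big_cons in_fsetU mem_cat.
Qed.

Section GraphEnergy.
Variable R : realType.
Implicit Types (p x y : R * R) (f g : R * R -> R).
Local Notation F := (@vicsek_map R).
Local Notation centers := (vicsek_centers R).

Let in_square x := (0 <= x.1 <= 1) && (0 <= x.2 <= 1).

Lemma in_square_map p x : p \in centers -> in_square x -> in_square (F p x).
Proof.
by move/centers_bounds; rewrite /in_square vicsek_mapE /=; lra.
Qed.

(** Two different cells touch in at most one point, so they share no edge and the energy of the
    union of edge sets is the sum over the cells. *)
Lemma vicsek_cells_meet p p' x x' y y' : p \in centers -> p' \in centers ->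
  in_square x -> in_square x' -> in_square y -> in_square y' ->
  F p x = F p' x' -> F p y = F p' y' -> x != y -> p = p'.
Proof.
move=> pc pc'; have [//|np] := eqVneq p p'.
case: x y x' y' => [x1 x2] [y1 y2] [x1' x2'] [y1' y2']; rewrite /in_square !vicsek_mapE /=.
move=> hx hx' hy hy' [e1 e2] [e3 e4] /eqP[].
move: np e1 e2 e3 e4; case/mem_centersP: pc => [[]|] ->;
  case/mem_centersP: pc' => [[]|] -> /=; rewrite ?eqxx// => _ e1 e2 e3 e4;
  congr pair; lra.
Qed.

Lemma mem_boundary x : (x \in vicsek_boundary R) = (x \in vicsek_corners R).
Proof. by rewrite in_fset. Qed.

Lemma vicsek_edges_prop m e : e \in vicsek_edges R m ->
  [/\ in_square e.1, in_square e.2 & e.1 != e.2].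
Proof.
elim: m e => [|m IH] e.
  rewrite !inE /= => /andP[/andP[h1 h2] ne]; split => //.
    by move: h1; rewrite orbF /in_square => /or4P[] /eqP-> /=; lra.
  by move: h2; rewrite orbF /in_square => /or4P[] /eqP-> /=; lra.
move=> /bigfcupP[p]; rewrite andbT => pc /imfsetP[/= e' /IH[h1 h2 h3] ->] /=.
split; [exact: in_square_map|exact: in_square_map|].
by apply: contra h3 => /eqP/vicsek_map_inj/eqP.
Qed.

Lemma graph_energyS m f :
  graph_energy m.+1 f = \sum_(p <- centers) graph_energy m (f \o F p).
Proof.
rewrite /graph_energy -mulr_sumr; congr (_ * _).
rewrite [vicsek_edges R m.+1]/= big_bigfcup_disjoint.
- apply: eq_bigr => p _; rewrite big_imfset//= => -[x y] [x' y'] _ _ /= H.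
  by congr pair; apply: (@vicsek_map_inj _ p); [exact: (congr1 fst H)|exact: (congr1 snd H)].
- rewrite /= !inE !xpair_eqE !negb_or.
  by rewrite !(oner_eq0, eqxx, eq_sym 0 1, eq_sym 1 2^-1, eq_sym 0 2^-1, invr_eq0, pnatr_eq0)/= ?andbT ?invr_eq1 ?pnatr_eq1.
move=> p p' e pc pc' /imfsetP[/= d /vicsek_edges_prop[h1 h2 h3] dE].
move=> /imfsetP[/= d' /vicsek_edges_prop[h1' h2' h3']]; rewrite dE => H.
exact: (vicsek_cells_meet pc pc' h1 h1' h2 h2' (congr1 fst H) (congr1 snd H) h3).
Qed.

Lemma graph_energy0 f : graph_energy 0 f = corner_form f f.
Proof.
rewrite /graph_energy.
have pe : perm_eq (vicsek_edges R 0)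
    [seq e <- [seq (x, y) | x <- vicsek_corners R, y <- vicsek_corners R] | e.1 != e.2].
  apply: uniq_perm.
  - exact: fset_uniq.
  - apply: filter_uniq; apply: allpairs_uniq => [||[? ?] [? ?] _ _ [-> ->]//];
    by rewrite /= !inE !xpair_eqE !(oner_eq0, eqxx, eq_sym 0 1).
  move=> [x y]; rewrite mem_filter !in_fset !inE /= andbC; congr (_ && _).
  rewrite !xpair_eqE.
  by do 4 case: (x == _) => //=; do 4 case: (y == _) => //=.
rewrite (perm_big _ pe) big_filter big_mkcond big_allpairs_dep.
have E (x y : R * R) :
    (if x != y then `|f x - f y| ^+ 2 else 0) = increment2 f f x y.
  case: eqVneq => [->|_]; rewrite /increment2 ?subrr ?mul0r//.
  by rewrite -expr2 real_normK ?num_real.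
transitivity (2^-1 * \sum_(x <- vicsek_corners R) \sum_(y <- vicsek_corners R)
    increment2 f f x y).
  by congr (_ * _); apply: eq_bigr => x _; apply: eq_bigr => y _; exact: E.
by rewrite !big_cons !big_nil /corner_form /increment2 /vq1 /vq2 /vq3 /vq4; lra.
Qed.

Lemma graph_energyE m f : 3 ^+ m * graph_energy m f = En m f f.
Proof.
elim: m f => [|m IH] f; first by rewrite mul1r graph_energy0.
rewrite graph_energyS exprS -mulrA mulr_sumr /=.
by congr (_ * _); apply: eq_bigr => p _; exact: IH.
Qed.

End GraphEnergy.

(** * The energy of the statement identified with [EF] *)

Section EnergyForm.
Variables (R : realType) (K : set (R * R)) (hK : is_vicsek_set K).
Implicit Types (f g : R * R -> R).

Lemma energyE f : energy f = limn (fun m => (En m f f)%:E).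
Proof. by rewrite /energy; under eq_fun do rewrite graph_energyE. Qed.

Lemma energy_EF f : dom K f -> energy f = (EF f f)%:E.
Proof.
move=> df; rewrite energyE -EFin_lim//.
by apply/cvg_ex; exists (EF f f); exact: (EF_cvg hK).
Qed.

Lemma dom_energyP f : dom_energy K f <-> dom K f.
Proof.
split; last by move=> df; split; [apply/KcontP; case: df|rewrite energy_EF// ltry].
move=> [/KcontP fc]; rewrite energyE => ef; split=> //.
have nd : nondecreasing_seq (fun m => (En m f f)%:E).
  by move=> m n mn; rewrite lee_fin; exact: En_nondecreasing.
have h m : ((En m f f)%:E <= limn (fun m => (En m f f)%:E))%E.
  rewrite (cvg_lim _ (ereal_nondecreasing_cvgn nd))//.
  by apply: ereal_sup_ubound; exists m.
exists (fine (limn (fun m => (En m f f)%:E))) => m.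
rewrite -lee_fin fineK//; apply: fin_real; apply/andP; split=> //.
by apply: (lt_le_trans _ (h 0%N)); rewrite ltNyr.
Qed.

Lemma energy_formE f g : dom K f -> dom K g -> energy_form f g = EF f g.
Proof.
move=> df dg; rewrite /energy_form.
have ds : dom K (f \+ g) by exact: domD.
have dd : dom K (f \- g).
  apply: (dom_eq hK _ (domD hK df (domZ hK (-1) dg))) => x _.
  by rewrite mulN1r.
rewrite !energy_EF//=.
have E x : K x -> (f \+ g) x = 1 * f x + 1 * g x by rewrite /= !mul1r.
have E' x : K x -> (f \- g) x = 1 * f x + (-1) * g x by rewrite /= mul1r mulN1r.
rewrite (EF_lin hK df dg ds E) (EF_lin hK df dg dd E').
rewrite (EFC f) (EFC g) (EFC f) (EFC g).
rewrite (EF_lin hK df dg df E) (EF_lin hK df dg dg E) (EF_lin hK df dg df E') (EF_lin hK df dg dg E').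
by rewrite (EFC g f); lra.
Qed.

End EnergyForm.

(** * Integration against the self-similar measure; support, symmetry and oscillation *)

Lemma open_measurable_prod (R : realType) (U : set (R * R)) : open U -> measurable U.
Proof.
move=> oU.
pose B (i : (rat * rat) * (rat * rat)) : set (R * R) :=
  `]ratr i.1.1, ratr i.1.2[ `*` `]ratr i.2.1, ratr i.2.2[.
have -> : U = \bigcup_i (if `[< B i `<=` U >] then B i else set0).
  apply/seteqP; split=> [[x y] Uxy|z [i _]]; last by case: asboolP => // h /h.
  have /close_nbhs[e e0 he] : nbhs (x, y) U by exact: open_nbhs_nbhs.
  have rat_around (t : R) : exists a b : rat,
      [/\ ratr a < t, t < ratr b, t - e < ratr a & ratr b < t + e].
    have [|a] := @rat_in_itvoo R (t - e) t; first by lra.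
    have [|b] := @rat_in_itvoo R t (t + e); first by lra.
    by rewrite !in_itv /= => /andP[? ?] /andP[? ?]; exists a, b.
  have [a [b [h1 h2 h3 h4]]] := rat_around x.
  have [a' [b' [h1' h2' h3' h4']]] := rat_around y.
  exists ((a, b), (a', b')) => //.
  case: asboolP => [_|[]]; first by split; rewrite /= in_itv /= ?h1 ?h2 ?h1' ?h2'.
  move=> [s t] [/=]; rewrite !in_itv /= => /andP[? ?] /andP[? ?].
  by apply: he; rewrite /close /= !ltr_norml; lra.
apply: countable_bigcupT_measurable => // i.
by case: asboolP => // _; apply: measurableX; exact: measurable_itv.
Qed.

Section Integral.
Variables (R : realType) (K : set (R * R)) (mu : probability (R * R)%type R).
Hypotheses (hK : is_vicsek_set K) (hmu : self_similar_measure K mu).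
Implicit Types (p x y : R * R) (b : bool) (f g : R * R -> R).
Local Notation F := (@vicsek_map R).
Local Notation centers := (vicsek_centers R).

Definition Kint f : R := \int[mu]_(x in K) f x.

Lemma K_measurable : measurable K.
Proof.
rewrite -(setCK K); apply: measurableC; apply: open_measurable_prod.
by apply: closed_openC; exact: K_closed.
Qed.

Lemma Kcont_bounded f : Kcont K f -> exists2 M : R, 0 <= M & forall x, K x -> `|f x| <= M.
Proof.
move=> /KcontP fc; have [_ cK _] := hK.
have /compact_bounded/ex_strict_bound_gt0[M M0 hM] := continuous_compact fc cK.
by exists M => [|x Kx]; [exact: ltW|apply/ltW/hM; exists x].
Qed.

Lemma Kcont_integrable f : Kcont K f -> mu.-integrable K (EFin \o f).
Proof.
move=> fc; apply: measurable_bounded_integrable.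
- exact: K_measurable.
- by rewrite (le_lt_trans (probability_le1 _ _)) ?ltry//; exact: K_measurable.
- apply: (measurability _ (measurable_realfun.RGenOpens.measurableE R)).
  move=> _ [_ [a [b ->] <-]].
  have /KcontP/continuousP cf := fc.
  have /open_subspaceP[V oV VK] := cf _ (@interval_open R (BRight a) (BLeft b) isT isT).
  rewrite setIC -VK; apply: measurableI; last exact: K_measurable.
  exact: open_measurable_prod.
- have [M M0 hM] := Kcont_bounded fc.
  exists M; split; first exact: num_real.
  by move=> N MN x Kx; apply: (le_trans (hM x Kx)); exact: ltW.
Qed.

Lemma Kint_eq f g : (forall x, K x -> f x = g x) -> Kint f = Kint g.
Proof. by move=> h; apply: eq_Rintegral => x /set_mem; exact: h. Qed.

Lemma Kint_lin (a b : R) f g : Kcont K f -> Kcont K g ->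
  Kint (fun x => a * f x + b * g x) = a * Kint f + b * Kint g.
Proof.
move=> fc gc; have mK := K_measurable.
have ac := KcontM (@Kcont_cst _ K a) fc; have bc := KcontM (@Kcont_cst _ K b) gc.
rewrite /Kint RintegralD//; [|exact: Kcont_integrable|exact: Kcont_integrable].
by rewrite !RintegralZl//; exact: Kcont_integrable.
Qed.

Lemma Kint_le f g : Kcont K f -> Kcont K g -> (forall x, K x -> f x <= g x) -> Kint f <= Kint g.
Proof.
move=> fc gc h; apply: le_Rintegral => //; first exact: K_measurable.
  exact: Kcont_integrable.
exact: Kcont_integrable.
Qed.

Lemma Kint_cst a : Kint (fun=> a) = a.
Proof.
have [h _] := hmu; rewrite /Kint Rintegral_cst; last exact: K_measurable.
by rewrite (_ : fine (mu K) = 1) ?mulr1 // h.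
Qed.

Lemma Kint_self f : Kcont K f -> Kint f = 5^-1 * \sum_(p <- centers) Kint (f \o F p).
Proof. by move=> /KcontP; have [_ h] := hmu; exact: h. Qed.

Lemma Kint_norm_le f (e : R) : Kcont K f -> (forall x, K x -> `|f x| <= e) -> `|Kint f| <= e.
Proof.
move=> fc h; rewrite ler_norml; apply/andP; split.
  rewrite -[leLHS]Kint_cst; apply: Kint_le => //; first exact: Kcont_cst.
  by move=> x /h; rewrite ler_norml => /andP[].
rewrite -[leRHS]Kint_cst; apply: Kint_le => //; first exact: Kcont_cst.
by move=> x /h; rewrite ler_norml => /andP[].
Qed.

Lemma sum_centers_le (V : R * R -> R) (e : R) :
  (forall p, p \in centers -> `|V p| <= e) -> `|5^-1 * \sum_(p <- centers) V p| <= e.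
Proof.
move=> h; rewrite normrM gtr0_norm ?invr_gt0// mulrC ler_pdivrMr//.
apply: (le_trans (ler_norm_sum _ _ _)); rewrite big_seq.
apply: (le_trans (ler_sum _ h)); rewrite -big_seq.
by rewrite big_centers; lra.
Qed.

(** The cell of level [n] around [x] has weight [5 ^- n] under self-similarity. Every neighbourhood
    of a point of [K] is thus charged, which makes the integral strictly positive on nonzero
    nonnegative continuous functions. *)
Lemma Kint_ge_cell (n : nat) x f (a : R) : K x -> Kcont K f -> (forall y, K y -> 0 <= f y) ->
  (forall y, K y -> close (2 / 3 ^+ n) x y -> a <= f y) -> a / 5 ^+ n <= Kint f.
Proof.
elim: n x f => [|n IH] x f Kx fc f0 h.
  rewrite expr0 divr1 -(Kint_cst a); apply: Kint_le => //; first exact: Kcont_cst.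
  move=> y Ky; apply: h => //.
  have := K_box hK Kx; have := K_box hK Ky.
  by rewrite /close expr0 divr1 !ltr_norml; lra.
have [p pc [z Kz xE]] := K_case hK Kx.
have {}IH : a / 5 ^+ n <= Kint (f \o F p).
  apply: (IH z) => //; first exact: Kcont_map.
    by move=> y Ky; apply: f0; exact: K_map.
  move=> y Ky zy; apply: h; first exact: K_map.
  by rewrite xE close_map; apply: closeW zy; rewrite exprS invfM; lra.
rewrite Kint_self// exprS invfM mulrCA ler_pM2l ?invr_gt0//.
apply: (le_trans IH); apply: (@le_sum_centers _ (fun q => Kint (f \o F q))) => // q qc.
rewrite -(Kint_cst 0); apply: Kint_le; [exact: Kcont_cst|exact: Kcont_map|].
by move=> y Ky; apply: f0; exact: K_map.
Qed.

Lemma Kint_pos f : Kcont K f -> (forall x, K x -> 0 <= f x) -> Kint f <= 0 ->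
  forall x, K x -> f x = 0.
Proof.
move=> fc f0 If x Kx; apply/eqP; rewrite eq_le f0// andbT leNgt; apply/negP => fx.
have fx2 : 0 < f x / 2 by lra.
have [d d0 hd] := fc x Kx _ fx2.
have [n hn] := @exp3_small R 2 _ d0.
suff h : forall y, K y -> close (2 / 3 ^+ n) x y -> f x / 2 <= f y.
  have := le_trans (Kint_ge_cell Kx fc f0 h) If.
  by apply/negP; rewrite -ltNge divr_gt0// exprn_gt0.
move=> y Ky /(closeW (ltW hn)) /(hd y Ky).
by rewrite ltr_norml; lra.
Qed.

Fixpoint osc (m : nat) (e : R) f : Prop :=
  if m is n.+1 then forall p, p \in centers -> osc n e (f \o F p)
  else forall x y, K x -> K y -> `|f x - f y| <= e.

(** The Riemann sum over the centres of the [5 ^ m] cells of level [m]. Being a finite sum, it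
    commutes with pointwise limits. *)
Fixpoint quadrature (m : nat) f : R :=
  if m is n.+1 then 5^-1 * \sum_(p <- centers) quadrature n (f \o F p)
  else f (vc R).

Lemma Kint_quadrature m e f : Kcont K f -> osc m e f -> `|Kint f - quadrature m f| <= e.
Proof.
elim: m f => [|m IH] f fc /= h.
  have [_ _ _ _ Kc] := vq_K hK.
  rewrite -(Kint_cst (f (vc R))).
  have -> : Kint f - Kint (fun=> f (vc R)) = Kint (fun x => 1 * f x + (-1) * f (vc R)).
    by rewrite Kint_lin ?mul1r ?mulN1r//; exact: Kcont_cst.
  apply: Kint_norm_le => [|x Kx]; last by rewrite mul1r mulN1r h.
  by apply: KcontD; apply: KcontM => //; exact: Kcont_cst.
rewrite Kint_self// -mulrBr -sumrB; apply: sum_centers_le => p pc.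
by apply: IH; [exact: Kcont_map|exact: h].
Qed.

(** The measure is known only through its self-similarity, so its symmetry has to be derived: a
    reflection permutes the equally weighted cells of level [m], and only the oscillation inside a
    cell remains as an error. *)
Lemma Kint_reflection_osc m e b f : Kcont K f -> osc m e f ->
  `|Kint (f \o reflection b) - Kint f| <= e.
Proof.
elim: m f => [|m IH] f fc /= h; have rc := Kcont_reflection hK b fc.
  have -> : Kint (f \o reflection b) - Kint f =
      Kint (fun x => 1 * (f \o reflection b) x + (-1) * f x).
    by rewrite Kint_lin// mul1r mulN1r.
  apply: Kint_norm_le => [|x Kx]; last by rewrite mul1r mulN1r h//; exact: K_reflection.
  by apply: KcontD; apply: KcontM => //; exact: Kcont_cst.
have -> : Kint (f \o reflection b) =
    5^-1 * \sum_(p <- centers) Kint ((f \o F p) \o reflection b).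
  rewrite Kint_self//; congr (_ * _).
  have E p : (f \o reflection b) \o F p = (f \o F (reflection b p)) \o reflection b.
    by apply/funext => x /=; rewrite reflection_map.
  under eq_bigr do rewrite E.
  rewrite !big_centers.
  have cE : (1 - 2^-1 : R) = 2^-1 by lra.
  by case: b {IH E rc}; rewrite /reflection /vq1 /vq2 /vq3 /vq4 /vc /= ?subr0 ?subrr ?cE; ring.
rewrite Kint_self// -mulrBr -sumrB; apply: sum_centers_le => p pc.
by apply: IH; [exact: Kcont_map|exact: h].
Qed.

Lemma osc_mul m (e e' M M' : R) f g : 0 <= M -> 0 <= M' ->
  (forall x, K x -> `|f x| <= M) -> (forall x, K x -> `|g x| <= M') ->
  osc m e f -> osc m e' g -> osc m (M * e' + M' * e) (fun x => f x * g x).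
Proof.
elim: m f g => [|m IH] f g M0 M0' fM gM /= hf hg.
  move=> x y Kx Ky.
  have -> : f x * g x - f y * g y = f x * (g x - g y) + g y * (f x - f y) by ring.
  apply: (le_trans (ler_normD _ _)); rewrite !normrM.
  by rewrite lerD// ler_pM//; [exact: fM|exact: hg|exact: gM|exact: hf].
move=> p pc; apply: IH => //; [..|exact: hf|exact: hg].
  by move=> x Kx; apply: fM; exact: K_map.
by move=> x Kx; apply: gM; exact: K_map.
Qed.

(** One cell carries at most a third of the energy, and [1 / 3 <= (3 / 5) ^+ 2]: the constant
    [3 / 5] is a rational bound for [1 / sqrt 3]. *)
Lemma En_cell_le f (D : R) m q : (forall m, En m f f <= D ^+ 2) ->
  q \in centers -> En m (f \o F q) (f \o F q) <= (3 / 5 * D) ^+ 2.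
Proof.
move=> fD qc.
have := @le_sum_centers R (fun j => En m (f \o F j) (f \o F j)) q qc
  (fun j _ => En_ge0 m (f \o F j)).
by have := fD m.+1; have := sqr_ge0 D; rewrite /= exprMn; lra.
Qed.

(* Along nested cells the corner values are linked by paths of three edges of
   the next level, each of increment at most 3/5 of the previous bound D. *)
Lemma dom_diameter f (D : R) : 0 <= D -> Kcont K f -> (forall m, En m f f <= D ^+ 2) ->
  forall x y, K x -> K y -> `|f x - f y| <= 9 * D.
Proof.
move=> D0 fc fD.
(* The constant solves [C = 3 / 5 * C + 9 / 5]: the estimate inside the cell with bound [3 / 5 * D],
   plus three edges. *)
suff h x : K x -> `|f x - f (vq2 R)| <= 9 / 2 * D.
  move=> x y /h hx /h hy; have := ler_distD (f (vq2 R)) (f x) (f y).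
  by rewrite (distrC (f (vq2 R))); lra.
move=> Kx; apply/ler_addgt0Pr => e e0.
have [d d0 hd] := fc x Kx e e0.
have [n hn] := @exp3_small R 2 _ d0.
suff [y [Ky xy hy]] : exists y,
    [/\ K y, close (2 / 3 ^+ n) x y & `|f y - f (vq2 R)| <= 9 / 2 * D].
  have := hd y Ky (closeW (ltW hn) xy); have := ler_distD (f y) (f x) (f (vq2 R)).
  by lra.
clear e e0 d d0 hd hn; elim: n x f D D0 fc fD Kx => [|n IH] x f D D0 fc fD Kx.
  exists (vq2 R); have [_ K2 _ _ _] := vq_K hK; split => //.
    have := K_box hK Kx; rewrite /close expr0 divr1 !ltr_norml /vq2 /=; lra.
  by rewrite subrr normr0 mulr_ge0// divr_ge0.
have [p pc [z Kz xE]] := K_case hK Kx.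
have D'0 : 0 <= 3 / 5 * D by lra.
have [y [Ky zy hy]] := IH z (f \o F p) (3 / 5 * D) D'0 (Kcont_map hK pc fc)
  (fun m => En_cell_le m fD pc) Kz.
exists (F p y); split; first exact: K_map.
  by rewrite xE close_map; apply: closeW zy; rewrite exprS invfM; lra.
have edge q : q \in centers -> let h := f \o F q in
    [/\ `|h (vq1 R) - h (vq2 R)| <= 3 / 5 * D, `|h (vq2 R) - h (vq3 R)| <= 3 / 5 * D,
     `|h (vq2 R) - h (vq4 R)| <= 3 / 5 * D, `|h (vq1 R) - h (vq3 R)| <= 3 / 5 * D
     & `|h (vq3 R) - h (vq4 R)| <= 3 / 5 * D].
  move=> qc h; have := En_cell_le 0 fD qc; rewrite -/h /= /corner_form /increment2 -!expr2.
  have S (s : R) : s ^+ 2 <= (3 / 5 * D) ^+ 2 -> `|s| <= 3 / 5 * D.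
    by move=> h2; rewrite -(@ler_pXn2r _ 2)// ?nnegrE// real_normK ?num_real.
  move=> hS; have s1 := sqr_ge0 (h (vq1 R) - h (vq2 R)).
  have s2 := sqr_ge0 (h (vq1 R) - h (vq3 R)).
  have s3 := sqr_ge0 (h (vq1 R) - h (vq4 R)).
  have s4 := sqr_ge0 (h (vq2 R) - h (vq3 R)).
  have s5 := sqr_ge0 (h (vq2 R) - h (vq4 R)).
  have s6 := sqr_ge0 (h (vq3 R) - h (vq4 R)).
  by split; apply: S; lra.
have [J1 J2 J3 J4] := vicsek_junctions R.
have c2 : vq2 R \in centers by apply/mem_centersP; left; constructor 2.
have c5 : vc R \in centers by apply/mem_centersP; right.
have [_ _ e2 _ _] := edge (vq2 R) c2; have [e51 e52 e53 _ _] := edge (vc R) c5.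
move: hy; rewrite /= => hy.
have T (s t u v : R) : `|s - v| <= `|s - t| + `|t - u| + `|u - v|.
  have := ler_distD t s v; have := ler_distD u t v; lra.
suff : `|f (F p (vq2 R)) - f (vq2 R)| <= 9 / 5 * D.
  have := ler_distD (f (F p (vq2 R))) (f (F p y)) (f (vq2 R)); lra.
have F22 : F (vq2 R) (vq2 R) = vq2 R := vicsek_map_fix _.
move: e2 e51 e52 e53; rewrite /= F22 J2 => e2 e51 e52 e53.
rewrite distrC in e2; rewrite distrC in e52; rewrite distrC in e53.
have [e1 e2' _ _ _] := edge p pc; move: e1 e2' => /=.
case/mem_centersP: pc => [[]|] ->; rewrite ?F22 ?J1 ?J3 ?J4 => e1 e2'.
- have := T (f (F (vq1 R) (vq2 R))) (f (F (vc R) (vq1 R))) (f (F (vc R) (vq2 R))) (f (vq2 R)).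
  by lra.
- by rewrite subrr normr0; lra.
- have := T (f (F (vq3 R) (vq2 R))) (f (F (vc R) (vq3 R))) (f (F (vc R) (vq2 R))) (f (vq2 R)).
  by rewrite distrC in e1; lra.
- have := ler_distD (f (F (vc R) (vq2 R))) (f (F (vc R) (vq4 R))) (f (vq2 R)).
  by lra.
- by lra.
Qed.

Lemma dom_osc m f (D : R) : 0 <= D -> Kcont K f -> (forall m, En m f f <= D ^+ 2) ->
  osc m (9 * D * (3 / 5) ^+ m) f.
Proof.
elim: m f D => [|m IH] f D D0 fc fD /=; first by rewrite expr0 mulr1; exact: dom_diameter.
move=> p pc; rewrite exprS mulrA -[9 * D * _]mulrA (mulrC D).
by apply: IH; [lra|exact: Kcont_map|move=> n; exact: En_cell_le].
Qed.

Lemma dom_bound f : dom K f -> exists2 D : R, 0 <= D & forall m, En m f f <= D ^+ 2.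
Proof.
move=> [fc [B hB]]; exists (1 + `|B|) => [|m]; first by rewrite addr_ge0.
by apply: (le_trans (hB m)); have := ler_norm B; have := normr_ge0 B; nra.
Qed.

Lemma Kint_reflection b f g : dom K f -> dom K g ->
  Kint (fun x => f (reflection b x) * g (reflection b x)) = Kint (fun x => f x * g x).
Proof.
move=> df dg; have [fc gc] := (df.1, dg.1).
have [D D0 hD] := dom_bound df; have [D' D'0 hD'] := dom_bound dg.
have [M M0 hM] := Kcont_bounded fc; have [M' M'0 hM'] := Kcont_bounded gc.
apply/eqP; rewrite -subr_eq0 -normr_le0; apply/ler_addgt0Pr => e e0; rewrite add0r.
pose C := M * (9 * D') + M' * (9 * D).
have C0 : 0 <= C by rewrite addr_ge0// mulr_ge0// mulr_ge0.
have [n hn] := exp35_small C e0.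
apply: le_trans (ltW hn).
have := osc_mul M0 M'0 hM hM' (dom_osc n D0 fc hD) (dom_osc n D'0 gc hD').
rewrite !mulrA -mulrDl => /(Kint_reflection_osc b (KcontM fc gc)).
by rewrite /C !mulrA.
Qed.

End Integral.

(** * The form [NF], minimizers, and compactness of the energy ball *)

Section Forms.
Variables (R : realType) (K : set (R * R)) (mu : probability (R * R)%type R).
Hypotheses (hK : is_vicsek_set K) (hmu : self_similar_measure K mu).
Implicit Types (p x y : R * R) (b : bool) (f g v w : R * R -> R).
Local Notation F := (@vicsek_map R).
Local Notation centers := (vicsek_centers R).
Local Notation dom := (dom K).

Definition ip f g : R := Kint K mu (fun x => f x * g x).

Lemma ipC f g : ip f g = ip g f.
Proof. by apply: Kint_eq => x _; rewrite mulrC. Qed.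

Lemma ip_eq f f' g g' : (forall x, K x -> f x = f' x) ->
  (forall x, K x -> g x = g' x) -> ip f g = ip f' g'.
Proof. by move=> h h'; apply: Kint_eq => x Kx; rewrite h// h'. Qed.

Lemma ip_lin (a b : R) f f1 f2 g : dom f1 -> dom f2 -> dom g ->
  (forall x, K x -> f x = a * f1 x + b * f2 x) ->
  ip f g = a * ip f1 g + b * ip f2 g.
Proof.
move=> [d1 _] [d2 _] [dg _] h; rewrite /ip -(Kint_lin mu hK); [|exact: KcontM|exact: KcontM].
by apply: Kint_eq => x Kx; rewrite h//; ring.
Qed.

Lemma ip_reflection b f g : dom f -> dom g ->
  ip (f \o reflection b) (g \o reflection b) = ip f g.
Proof. exact: (Kint_reflection hK hmu). Qed.

Lemma ip_ge0 f g : dom f -> dom g -> (forall x, K x -> 0 <= f x * g x) -> 0 <= ip f g.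
Proof.
move=> [df _] [dg _] h; rewrite -(Kint_cst hK hmu 0).
by apply: (Kint_le mu hK) => //; [exact: Kcont_cst|exact: KcontM].
Qed.

Lemma ip_eq0 f g : (forall x, K x -> f x * g x = 0) -> ip f g = 0.
Proof. by move=> h; rewrite -[RHS](Kint_cst hK hmu 0); apply: Kint_eq. Qed.

Lemma ip_definite f : dom f -> ip f f <= 0 -> forall x, K x -> f x = 0.
Proof.
move=> [df _] h x Kx; apply/eqP; rewrite -sqrf_eq0 expr2; apply/eqP.
apply: (@Kint_pos _ _ _ hK hmu (fun x => f x * f x)) => //; first exact: KcontM.
by move=> y _; rewrite -expr2 sqr_ge0.
Qed.

(* The quadratic form of the equation E(f, g) = l <f, g>. *)
Definition NF (l : R) f g : R := EF f g - l * ip f g.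

Lemma NFC l f g : NF l f g = NF l g f.
Proof. by rewrite /NF EFC ipC. Qed.

Lemma NF_lin l (a b : R) f f1 f2 g : dom f1 -> dom f2 -> dom g ->
  (forall x, K x -> f x = a * f1 x + b * f2 x) ->
  NF l f g = a * NF l f1 g + b * NF l f2 g.
Proof.
move=> d1 d2 dg h.
by rewrite /NF (EF_lin hK d1 d2 dg h) (ip_lin d1 d2 dg h); ring.
Qed.

Lemma NF_eq l f f' g g' : (forall x, K x -> f x = f' x) ->
  (forall x, K x -> g x = g' x) -> NF l f g = NF l f' g'.
Proof. by move=> h h'; rewrite /NF (EF_eq hK h h') (ip_eq h h'). Qed.

Lemma NF_reflection l b f g : dom f -> dom g ->
  NF l (f \o reflection b) (g \o reflection b) = NF l f g.
Proof. by move=> df dg; rewrite /NF EF_reflection ip_reflection. Qed.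

Lemma NF_sqrD l (a b : R) f g h : dom f -> dom g ->
  (forall x, K x -> h x = a * f x + b * g x) ->
  NF l h h = a ^+ 2 * NF l f f + 2 * a * b * NF l f g + b ^+ 2 * NF l g g.
Proof.
move=> df dg hE.
have dh : dom h.
  by apply: (dom_eq hK _ (dom_lin hK a b df dg)) => x Kx; rewrite hE.
rewrite (NF_lin l df dg dh hE) (NFC l f) (NFC l g).
rewrite (NF_lin l df dg df hE) (NF_lin l df dg dg hE) (NFC l g f); ring.
Qed.

Lemma quadratic_ge0_linear (a b c : R) : a <= 0 ->
  (forall t, 0 <= a + 2 * t * b + t ^+ 2 * c) -> b = 0.
Proof.
move=> a0 h; have k0 : 0 < `|c| + 1 by rewrite ltr_wpDl.
(* At this point the quadratic equals [a - s ^+ 2 * (2 * (|c| + 1) - c)], whose bracket is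
   positive. *)
have := h (- b / (`|c| + 1)); set s := b / (`|c| + 1).
have bE : b = s * (`|c| + 1) by rewrite /s divfK// gt_eqF.
rewrite mulNr -/s bE => h'.
suff /eqP : s ^+ 2 = 0 by rewrite sqrf_eq0 => /eqP ->; rewrite mul0r.
apply/eqP; rewrite eq_le sqr_ge0 andbT.
have := sqr_ge0 s; have := ler_norm c; have := normr_ge0 c; nra.
Qed.

(** Where the form is nonnegative, a function at which it is at most 0 is a minimizer, and the first
    variation vanishes. The class [P] will be the odd functions or the functions vanishing at the
    centre. *)
Lemma minimizer_equation l (P : (R * R -> R) -> Prop) g :
  (forall v, P v -> dom v) ->
  (forall (t : R) v w, P v -> P w -> P (fun x => v x + t * w x)) ->
  (forall v, P v -> 0 <= NF l v v) -> P g -> NF l g g <= 0 ->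
  forall v, P v -> NF l g v = 0.
Proof.
move=> Pdom Plin Pge0 Pg g0 v Pv.
apply: (quadratic_ge0_linear (c := NF l v v) g0) => t.
have := Pge0 _ (Plin t g v Pg Pv).
rewrite (@NF_sqrD l 1 t g v)//; first by lra.
  exact: Pdom.
  exact: Pdom.
by move=> x _; rewrite mul1r.
Qed.

(** The radius depends on [x] and [m] alone and not on [f]: a family with common oscillation bounds
    is equicontinuous. *)
Lemma osc_local m x : K x -> exists2 d : R, 0 < d & forall y, K y -> close d x y ->
  forall e f, osc K m e f -> `|f x - f y| <= e.
Proof.
elim: m x => [|m IH] x Kx; first by exists 1 => // y Ky _ e f /=; exact.
have /choice[dl hdl] : forall z, exists d : R, 0 < d /\ (K z ->
    forall y, K y -> close d z y -> forall e f, osc K m e f -> `|f z - f y| <= e).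
  move=> z; have [/IH[d d0 hd]|nKz] := pselect (K z); first by exists d.
  by exists 1; split.
have [d d0 hd] := local_cell hK Kx (fun p y => (hdl y).1).
exists d => // y Ky /(hd y Ky)[p pc [x' [y' [Kx' Ky' -> -> xy]]]] e f /= /(_ p pc).
by apply: (hdl x').2.
Qed.

Lemma ultra_fmap (S T : Type) (f : S -> T) (U : set_system S) :
  UltraFilter U -> UltraFilter (f @ U).
Proof.
move=> UU; split; first exact: fmap_proper_filter.
move=> G GG UG; apply/seteqP; split=> // A GA.
have [//|UnA] := in_ultra_setVsetC (f @^-1` A) UU.
have /UG GnA : (f @ U) (~` A) by [].
by have [t []] := filter_ex (filterI GA GnA).
Qed.

Lemma En_ultra (U : set_system nat) (w : nat -> R * R -> R) g m : UltraFilter U ->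
  (forall x, K x -> w n x @[n --> U] --> g x) ->
  En m (w n) (w n) @[n --> U] --> En m g g.
Proof.
move=> UU; elim: m w g => [|m IH] w g wg /=.
  have [K1 K2 K3 K4 _] := vq_K hK.
  by rewrite /corner_form /increment2; do ?[apply: cvgD]; apply: cvgM; apply: cvgB; exact: wg.
apply: cvgMr; rewrite big_seq; under eq_fun do rewrite big_seq.
apply: cvg_big => [|p pc]; first exact: add_continuous.
by apply: (IH (fun n => w n \o F p)) => x Kx; apply: wg; exact: K_map.
Qed.

Lemma quadrature_ultra (U : set_system nat) (w : nat -> R * R -> R) g m : UltraFilter U ->
  (forall x, K x -> w n x @[n --> U] --> g x) ->
  quadrature m (w n) @[n --> U] --> quadrature m g.
Proof.
move=> UU; elim: m w g => [|m IH] w g wg /=.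
  by have [_ _ _ _ Kc] := vq_K hK; exact: wg.
apply: cvgMr; rewrite big_seq; under eq_fun do rewrite big_seq.
apply: cvg_big => [|p pc]; first exact: add_continuous.
by apply: (IH (fun n => w n \o F p)) => x Kx; apply: wg; exact: K_map.
Qed.

(** An ultrafilter gives a pointwise limit of the values, which lie in [[-9, 9]]. Energies of fixed
    level pass to the limit, the common oscillation bound makes it continuous, and the quadrature
    error is uniform, so [ip (w n) (w n)] converges along the ultrafilter. The clause with the
    factor [a] transports oddness. *)
Lemma dom_compact (w : nat -> R * R -> R) :
  (forall n, dom (w n)) -> (forall n m, En m (w n) (w n) <= 1) ->
  (forall n, w n (vc R) = 0) ->
  exists g, [/\ dom g, EF g g <= 1,
    forall (a : R) x y, K x -> K y -> (forall n, w n x = a * w n y) -> g x = a * g y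
    & forall (N : nat) (e : R), 0 < e ->
        exists2 n, (N <= n)%N & `|ip (w n) (w n) - ip g g| < e].
Proof.
move=> wd w1 wc.
have [_ _ _ _ Kc] := vq_K hK.
have one0 : (0 : R) <= 1 by [].
have w1' n m : En m (w n) (w n) <= 1 ^+ 2 by rewrite expr1n.
have w9 n x : K x -> `|w n x| <= 9.
  move=> Kx; have := dom_diameter hK one0 (wd n).1 (w1' n) Kx Kc.
  by rewrite wc subr0 mulr1.
have [U [UU subU]] := @ultraFilterLemma _ \oo _.
have /choice[g hg] : forall x, exists a : R, K x -> w n x @[n --> U] --> a.
  move=> x; have [Kx|nKx] := pselect (K x); last by exists 0.
  have : compact `[- 9 : R, 9] by exact: segment_compact.
  rewrite compact_ultra => /(_ (w n x @[n --> U]) (ultra_fmap _ UU))[].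
    by apply: (@filterE _ U) => n /=; rewrite in_itv /=; have := w9 n x Kx; rewrite ler_norml.
  by move=> a [_ ha]; exists a.
have En1 m : En m g g <= 1.
  by apply: (cvgr_to_le (En_ultra (m := m) UU hg)); exact: nearW.
have gc : Kcont K g.
  move=> x Kx e e0; have e20 : 0 < e / 2 by lra.
  have [m hm] := exp35_small 9 e20.
  have [d d0 hd] := osc_local m Kx.
  exists d => // y Ky xy; apply: (@le_lt_trans _ _ (e / 2)); last lra.
  have /cvgr_to_le : `|w n x - w n y| @[n --> U] --> `|g x - g y|.
    by apply: cvg_norm; apply: cvgB; exact: hg.
  apply; apply: nearW => n; apply: (le_trans _ (ltW hm)).
  by have := dom_osc hK m one0 (wd n).1 (w1' n); rewrite mulr1 => /(hd y Ky xy).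
have dg : dom g by split=> //; exists 1.
exists g; split=> //.
- by apply: (cvgr_to_le (EF_cvg hK dg dg)); exact: nearW.
- move=> a x y Kx Ky h.
  have h1 : w n x @[n --> U] --> a * g y.
    by under eq_fun do rewrite h; apply: cvgMr; exact: hg.
  exact: (cvg_unique _ (hg x Kx) h1).
move=> N e e0; have e30 : 0 < e / 3 by lra.
(* The product rule for oscillations, with values bounded by 9 and oscillation
   [9 * (3 / 5) ^+ m]. *)
have [m hm] := exp35_small (9 * 9 + 9 * 9) e30.
have quad f : dom f -> (forall m, En m f f <= 1 ^+ 2) -> f (vc R) = 0 ->
    `|ip f f - quadrature m (fun x => f x * f x)| < e / 3.
  move=> df f1 fc0; apply: le_lt_trans hm.
  have f9 x : K x -> `|f x| <= 9.
    by move=> Kx; have := dom_diameter hK one0 df.1 f1 Kx Kc; rewrite fc0 subr0 mulr1.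
  have f9' := dom_osc hK m one0 df.1 f1.
  have n0 : (0 : R) <= 9 by [].
  have := osc_mul hK n0 n0 f9 f9 f9' f9'; rewrite mulr1 !mulrA -mulrDl => h.
  by apply: (Kint_quadrature hK hmu) h; exact: KcontM df.1 df.1.
have gc0 : g (vc R) = 0.
  have h0 : w n (vc R) @[n --> U] --> (0 : R).
    by rewrite (_ : (fun n => w n _) = fun=> 0); [exact: cvg_cst|apply/funext].
  exact: (cvg_unique _ (hg _ Kc) h0).
have q2 : quadrature m (fun x => w n x * w n x) @[n --> U] -->
    quadrature m (fun x => g x * g x).
  by apply: quadrature_ultra => x Kx; apply: cvgM; exact: hg.
have /cvgrPdist_lt/(_ _ e30) near1 := q2.
have near2 : \forall n \near U, (N <= n)%N by apply: subU; exists N.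
have [n [hn1 hn2]] := filter_ex (filterI near1 near2).
exists n => //.
have := quad _ (wd n) (w1' n) (wc n).
have En1' k : En k g g <= 1 ^+ 2 by rewrite expr1n.
have := quad _ dg En1' gc0.
by move: hn1; rewrite !ltr_norml; lra.
Qed.

End Forms.

(** * Soft thresholding of real numbers *)

Section Threshold.
Variable R : realType.
Implicit Types e s t : R.

(** Soft thresholding moves [t] towards 0 by [e], stopping at 0. Unlike a hard cutoff it is
    1-Lipschitz, so it does not raise the energy. *)
Definition threshold e t : R := Num.max (t - e) 0 + Num.min (t + e) 0.

Let thresholdP e t : 0 <= e -> [\/ e <= t /\ threshold e t = t - e,
  t <= - e /\ threshold e t = t + e | - e <= t <= e /\ threshold e t = 0].
Proof.
move=> e0; rewrite /threshold; have [h|h] := leP e t.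
  by constructor 1; split=> //; rewrite max_l ?min_r; lra.
have [h'|h'] := leP t (- e).
  by constructor 2; split=> //; rewrite max_r ?min_l; lra.
by constructor 3; split; [lra|rewrite max_r ?min_r; lra].
Qed.

Lemma threshold_eq0 e t : `|t| <= e -> threshold e t = 0.
Proof.
move=> te; have e0 : 0 <= e := le_trans (normr_ge0 t) te.
by move: te; rewrite ler_norml; case: (thresholdP t e0) => -[h ->]; lra.
Qed.

Lemma threshold_lip e s t : 0 <= e -> `|threshold e s - threshold e t| <= `|s - t|.
Proof.
move=> e0; rewrite ler_normr !ler_norml.
by case: (thresholdP s e0) => -[hs ->]; case: (thresholdP t e0) => -[ht ->]; lra.
Qed.

Lemma threshold_sqr_ge e t : 0 <= e -> t * t - 2 * e * `|t| <= threshold e t * threshold e t.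
Proof.
move=> e0; have ee := sqr_ge0 e; case: (thresholdP t e0) => -[h ->].
- by rewrite ger0_norm; lra.
- by rewrite ler0_norm; lra.
by have [t0|t0] := leP 0 t; [rewrite ger0_norm//|rewrite ltr0_norm//]; nra.
Qed.

Lemma le_sqr_norm s t : `|s| <= `|t| -> s ^+ 2 <= t ^+ 2.
Proof.
move=> h; rewrite -[leLHS]real_normK ?num_real// -[leRHS]real_normK ?num_real//.
by rewrite lerXn2r ?nnegrE.
Qed.

End Threshold.

(** * Locality of the energy and cutting along a mirror line *)

Section Cut.
Variables (R : realType) (K : set (R * R)) (hK : is_vicsek_set K).
Implicit Types (p x y : R * R) (b : bool) (f g v : R * R -> R).
Local Notation dom := (dom K).

(** Edges of coarse graphs may be longer than [d]; by monotonicity their energy is bounded by that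
    of a fine level, where the local hypothesis applies. *)
Lemma dom_local_lip (d : R) f g : 0 < d ->
  (forall x y, K x -> K y -> close d x y -> `|g x - g y| <= `|f x - f y|) ->
  dom f -> dom g.
Proof.
move=> d0 h [fc [B hB]]; split.
  move=> x Kx e e0; have [d' d'0 hd] := fc x Kx e e0.
  exists (Num.min d d'); first by rewrite lt_min d0.
  move=> y Ky xy; apply: (le_lt_trans (h _ _ Kx Ky _)).
    by apply: closeW xy; rewrite ge_min lexx.
  by apply: hd => //; apply: closeW xy; rewrite ge_min lexx orbT.
have [n hn] := @exp3_small R 2 _ d0.
exists B => m; apply: (@le_trans _ _ (En (maxn m n) g g)).
  by apply: En_nondecreasing; exact: leq_maxl.
apply: le_trans (hB (maxn m n)); apply: (En_le hK) => x y Kx Ky xy.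
rewrite /increment2 -!expr2; apply: le_sqr_norm; apply: h => //; apply: closeW xy.
apply: le_trans (ltW hn).
by rewrite ler_pM2l// lef_pV2 ?posrE ?exprn_gt0// ler_eXn2l ?ltr1n// leq_maxr.
Qed.

Lemma EF_separated (d : R) f g : 0 < d -> dom f -> dom g ->
  (forall x y, K x -> K y -> close d x y -> increment2 f g x y = 0) -> EF f g = 0.
Proof.
move=> d0 df dg h; have dz : dom (fun=> 0) := dom_cst K 0.
have zE x y : increment2 (fun=> 0 : R) (fun=> 0) x y = 0 by rewrite /increment2 subrr mul0r.
apply/eqP; rewrite eq_le; apply/andP; split.
  rewrite -[leRHS](EF_cst 0 (fun=> 0)).
  by apply: (EF_le hK d0) => // x y Kx Ky xy; rewrite zE h.
rewrite -[leLHS](EF_cst 0 (fun=> 0)).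
by apply: (EF_le hK d0) => // x y Kx Ky xy; rewrite zE h.
Qed.

Definition vanishing b (d : R) v := forall x, K x -> `|coord b x - 2^-1| < d -> v x = 0.

Definition cut b v x : R := if 2^-1 <= coord b x then v x else 0.

(** A close pair on opposite sides of the line lies in the strip where [v] vanishes, so the jump of
    the cut is never seen. *)
Lemma cut_cases b (d : R) v x y : 0 < d -> vanishing b d v -> K x -> K y -> close d x y ->
  [\/ cut b v x = v x /\ cut b v y = v y, cut b v x = 0 /\ cut b v y = 0
    | [/\ cut b v x = 0, cut b v y = 0, v x = 0 & v y = 0]].
Proof.
move=> d0 hv Kx Ky xy.
have {xy} : `|coord b x - coord b y| < d by case/andP: xy; case: (b).
rewrite ltr_norml /cut => xy.
have [hx|hx] := leP 2^-1 (coord b x); have [hy|hy] := leP 2^-1 (coord b y).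
- by constructor 1.
- have vx : v x = 0 by apply: hv => //; rewrite ltr_norml; lra.
  have vy : v y = 0 by apply: hv => //; rewrite ltr_norml; lra.
  by constructor 3.
- have vx : v x = 0 by apply: hv => //; rewrite ltr_norml; lra.
  have vy : v y = 0 by apply: hv => //; rewrite ltr_norml; lra.
  by constructor 3.
- by constructor 2.
Qed.

Lemma dom_cut b (d : R) v : 0 < d -> dom v -> vanishing b d v -> dom (cut b v).
Proof.
move=> d0 dv hv; apply: (dom_local_lip d0 _ dv) => x y Kx Ky xy.
case: (cut_cases d0 hv Kx Ky xy) => [[-> ->]//|[-> ->]|[-> -> -> ->]//].
by rewrite subrr normr0.
Qed.

Lemma dom_threshold (e : R) v : 0 <= e -> dom v -> dom (fun x => threshold e (v x)).
Proof.
by move=> e0; apply: (dom_lip hK (C := 1)) => x y _ _; rewrite mul1r threshold_lip.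
Qed.

(** The strip bounds one coordinate only; the cone condition bounds the other by three times as
    much, whence the radius [d / 3]. *)
Lemma near_center v (e : R) : Kcont K v -> v (vc R) = 0 -> 0 < e ->
  exists2 d : R, 0 < d & forall b x, K x -> `|coord b x - 2^-1| < d -> `|v x| < e.
Proof.
move=> fc vc0 e0; have [_ _ _ _ Kc] := vq_K hK.
have [d d0 hd] := fc _ Kc e e0.
exists (d / 3) => [|b x Kx hx]; first by lra.
have := hd x Kx; rewrite vc0 sub0r normrN; apply.
have := K_cone hK b Kx => hx'.
have {}hx' : `|coord (~~ b) x - 2^-1| < d by lra.
have {hx} : `|coord b x - 2^-1| < d by lra.
by move: hx'; rewrite /close (distrC _ x.1) (distrC _ x.2) /coord; case: b => /= -> ->.
Qed.

End Cut.

(** * The spectral gap for functions vanishing at the centre *)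

Section Gap.
Variables (R : realType) (K : set (R * R)) (mu : probability (R * R)%type R).
Hypotheses (hK : is_vicsek_set K) (hmu : self_similar_measure K mu).
Variable lam : R.
Hypothesis lam0 : 0 < lam.
Hypothesis lam_least : forall l g, 0 < l -> dom K g -> (exists2 x, K x & g x != 0) ->
  (forall v, dom K v -> NF K mu l g v = 0) -> lam <= l.
Implicit Types (p x y : R * R) (b : bool) (f g v w : R * R -> R).
Local Notation F := (@vicsek_map R).
Local Notation centers := (vicsek_centers R).
Local Notation dom := (dom K).
Local Notation ip := (ip K mu).
Local Notation NF := (NF K mu).
Local Notation c := (vc R).

Lemma reflection_center b : reflection b c = c.
Proof. by rewrite /reflection /vc /=; case: b; congr pair; lra. Qed.

Definition odd_dom v := dom v /\ forall x, K x -> v (reflection true x) = - v x.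

Lemma odd_dom_center v : odd_dom v -> v c = 0.
Proof.
have [_ _ _ _ Kc] := vq_K hK.
by move=> [_ /(_ _ Kc)]; rewrite reflection_center; lra.
Qed.

Lemma odd_dom_lin (t : R) v w : odd_dom v -> odd_dom w -> odd_dom (fun x => v x + t * w x).
Proof.
move=> [dv ov] [dw ow]; split; first exact: (domD hK dv (domZ hK t dw)).
by move=> x Kx; rewrite ov// ow//; ring.
Qed.

Lemma EF_center_bound v x : dom v -> EF v v <= 1 -> v c = 0 -> K x -> `|v x| <= 9.
Proof.
move=> dv v1 vc0 Kx; have [_ _ _ _ Kc] := vq_K hK.
have v1' m : En m v v <= 1 ^+ 2.
  by rewrite expr1n; apply: le_trans v1; exact: (En_le_EF hK).
have := dom_diameter hK ler01 dv.1 v1' Kx Kc.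
by rewrite vc0 subr0 mulr1.
Qed.

Lemma ip_scale (a : R) v : dom v -> ip (fun x => a * v x) (fun x => a * v x) = a ^+ 2 * ip v v.
Proof.
move=> dv.
have E x : K x -> a * v x = a * v x + 0 * v x by rewrite mul0r addr0.
rewrite (ip_lin mu hK dv dv (domZ hK a dv) E) mul0r addr0 ipC.
by rewrite (ip_lin mu hK dv dv dv E) mul0r addr0 mulrA expr2.
Qed.

Lemma EF_scale (a : R) v : dom v -> EF (fun x => a * v x) (fun x => a * v x) = a ^+ 2 * EF v v.
Proof.
move=> dv.
have E x : K x -> a * v x = a * v x + 0 * v x by rewrite mul0r addr0.
rewrite (EF_lin hK dv dv (domZ hK a dv) E) mul0r addr0 EFC.
by rewrite (EF_lin hK dv dv dv E) mul0r addr0 mulrA expr2.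
Qed.

Lemma EF_le0_center v : dom v -> EF v v <= 0 -> v c = 0 -> forall x, K x -> v x = 0.
Proof.
move=> dv v0 vc0 x Kx; have [_ _ _ _ Kc] := vq_K hK.
have v0' m : En m v v <= 0 ^+ 2.
  by rewrite expr0n /=; apply: le_trans v0; exact: (En_le_EF hK).
have := dom_diameter hK (lexx 0) dv.1 v0' Kx Kc.
by rewrite vc0 subr0 mulr0 normr_le0 => /eqP.
Qed.

(* The supremum S of <v, v> over odd v with E(v, v) <= 1 is attained by
   compactness, and a maximizer is an eigenfunction for 1/S. *)
Lemma odd_gap v : odd_dom v -> lam * ip v v <= EF v v.
Proof.
move=> ov; rewrite leNgt; apply/negP => vlt.
have [dv _] := ov.
have Ev : 0 < EF v v.
  rewrite lt_neqAle (EF_ge0 hK dv) andbT eq_sym; apply/negP => /eqP Ev0.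
  have Ev0' : EF v v <= 0 by rewrite Ev0.
  have v0 := EF_le0_center dv Ev0' (odd_dom_center ov).
  by move: vlt; rewrite Ev0 (ip_eq0 hK hmu) ?mulr0 ?ltxx// => x Kx; rewrite v0// mul0r.
pose A := [set ip w w | w in [set w | odd_dom w /\ EF w w <= 1]].
have normalized w : odd_dom w -> 0 < EF w w -> A (ip w w / EF w w).
  move=> ow Ew; have [dw ow'] := ow; exists (fun x => (Num.sqrt (EF w w))^-1 * w x).
    split; last by rewrite EF_scale// exprVn sqr_sqrtr ?(ltW Ew)// mulVf ?gt_eqF.
    by split; [exact: (domZ hK)|move=> x Kx; rewrite ow'// mulrN].
  by rewrite ip_scale// exprVn sqr_sqrtr ?(ltW Ew)// mulrC.
have hA : has_sup A.
  split; first by exists (ip v v / EF v v); exact: normalized.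
  exists (9 * 9) => _ [w [ow w1] <-].
  rewrite -(Kint_cst hK hmu (9 * 9)); apply: (Kint_le mu hK); [|exact: Kcont_cst|].
    by apply: KcontM; exact: ow.1.1.
  move=> x Kx; apply: (le_trans (ler_norm _)); rewrite normrM.
  by have h := EF_center_bound ow.1 w1 (odd_dom_center ow) Kx; exact: ler_pM.
pose S := sup A.
have AS a : A a -> a <= S by move=> Aa; apply: sup_upper_bound.
have Sv : ip v v <= S * EF v v by rewrite -ler_pdivrMr//; apply: AS; exact: normalized.
have lS : 1 < lam * S.
  by rewrite -(ltr_pM2r Ev) mul1r -mulrA (lt_le_trans vlt)// ler_pM2l.
have S0 : 0 < S by rewrite -(pmulr_rgt0 _ lam0) (lt_trans _ lS).
have /choice[w hw] : forall n : nat, exists w : R * R -> R,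
    [/\ odd_dom w, EF w w <= 1 & S - n.+1%:R^-1 < ip w w].
  move=> n; have e0 : 0 < n.+1%:R^-1 :> R by rewrite invr_gt0.
  by have [_ [w [ow w1] <-] hw] := sup_adherent e0 hA; exists w.
have wd n : dom (w n) by have [[]] := hw n.
have w1 n m : En m (w n) (w n) <= 1.
  by have [_ h _] := hw n; apply: le_trans h; exact: (En_le_EF hK).
have wc n : w n c = 0 by have [h _ _] := hw n; exact: odd_dom_center.
have [g [dg g1 gsym gip]] := dom_compact hK hmu wd w1 wc.
have og : odd_dom g.
  split=> // x Kx; rewrite (gsym (-1) (reflection true x) x) ?mulN1r//.
    exact: K_reflection.
  by move=> n; rewrite mulN1r; have [[_ h] _ _] := hw n; exact: h.
have Sg : S <= ip g g.
  apply/ler_addgt0Pr => e e0; have e20 : 0 < e / 2 by lra.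
  have [N hN] : exists N : nat, N.+1%:R^-1 < e / 2.
    exists (Num.truncn (e / 2)^-1); rewrite -[ltRHS]invrK ltf_pV2 ?posrE ?invr_gt0//.
    exact: truncnS_gt.
  have [n Nn] := gip N _ e20; rewrite ltr_norml => /andP[h1 h2].
  have [_ _ h3] := hw n.
  have h4 : n.+1%:R^-1 <= N.+1%:R^-1 :> R by rewrite lef_pV2 ?posrE// ler_nat.
  have := le_lt_trans h4 hN; move: h3; set a := _^-1.
  by move: a h1 h2 => a h1 h2 h3 h5; lra.
have Ngap u : odd_dom u -> 0 <= NF S^-1 u u.
  move=> ou; rewrite subr_ge0 mulrC ler_pdivrMr// mulrC.
  have [Eu|Eu] := ltP 0 (EF u u).
    by rewrite -ler_pdivrMr//; apply: AS; exact: normalized.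
  have u0 := EF_le0_center ou.1 Eu (odd_dom_center ou).
  rewrite (ip_eq0 hK hmu) => [|x Kx]; last by rewrite u0// mul0r.
  by apply: mulr_ge0; [exact: ltW|exact: (EF_ge0 hK ou.1)].
have Ng : NF S^-1 g g <= 0.
  by rewrite subr_le0 mulrC ler_pdivlMr// (le_trans _ Sg)// -[leRHS]mul1r ler_pM2r.
have Nodd u := minimizer_equation hK (fun u (h : odd_dom u) => h.1) odd_dom_lin Ngap og Ng (v := u).
have : lam <= S^-1.
  apply: (@lam_least _ g) => //; first by rewrite invr_gt0.
    apply: contrapT => h; move: Sg; rewrite leNgt => /negP; apply.
    rewrite (ip_eq0 hK hmu)// => x Kx.
    by have [->|gx] := eqVneq (g x) 0; [rewrite mul0r|case: h; exists x].
  (* The equation is known for odd tests. The even part [s] of a test is orthogonal to the odd [g]: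
     reflecting both arguments changes the sign of [NF S^-1 g s]. *)
  move=> u du; have du' := dom_reflection hK true du.
  pose o := fun x => 2^-1 * u x + (- 2^-1) * (u \o reflection true) x.
  pose s := fun x => 2^-1 * u x + 2^-1 * (u \o reflection true) x.
  have do_ : dom o by exact: (dom_lin hK).
  have ds : dom s by exact: (dom_lin hK).
  have uE x : K x -> u x = 1 * o x + 1 * s x by rewrite /o /s; lra.
  have go : NF S^-1 o g = 0.
    by rewrite NFC; apply: Nodd; split=> // x Kx; rewrite /o /comp reflectionK; lra.
  have gs : NF S^-1 g s = 0.
    have gE x : K x -> (g \o reflection true) x = -1 * g x + 0 * g x.
      by move=> Kx; rewrite /comp og.2//; lra.
    have sE x : K x -> (s \o reflection true) x = s x.
      by move=> Kx; rewrite /s /comp reflectionK addrC.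
    have := NF_reflection hK hmu S^-1 true dg ds.
    rewrite (NF_lin mu hK S^-1 dg dg (dom_reflection hK true ds) gE) mul0r addr0.
    by rewrite (NF_eq mu hK S^-1 (fun x _ => erefl (g x)) sE); lra.
  by rewrite NFC (NF_lin mu hK S^-1 do_ ds dg uE) go (NFC _ _ _ s) gs; lra.
by rewrite -[S^-1]mul1r ler_pdivlMr// leNgt lS.
Qed.

Definition half_supported (d : R) v := forall x, K x -> coord true x < 2^-1 + d -> v x = 0.

(** The odd extension [v - v o r] doubles both forms: the supports of [v] and its mirror image are
    separated, so the cross terms vanish. *)
Lemma half_gap (d : R) v : 0 < d -> dom v -> half_supported d v -> lam * ip v v <= EF v v.
Proof.
move=> d0 dv hv; have dv' := dom_reflection hK true dv.
pose o := fun x => 1 * v x + (-1) * (v \o reflection true) x.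
have oo : odd_dom o.
  split=> [|x Kx]; first exact: (dom_lin hK).
  by rewrite /o /comp reflectionK; lra.
have oE x : K x -> o x = 1 * v x + (-1) * (v \o reflection true) x by [].
have v'0 x : K x -> 2^-1 - d < coord true x -> (v \o reflection true) x = 0.
  move=> Kx hx; apply: hv; first exact: K_reflection.
  by rewrite /reflection /coord /= in hx *; lra.
have sep x : K x -> v x * (v \o reflection true) x = 0.
  move=> Kx; have [h|h] := ltP (coord true x) (2^-1 + d).
    by rewrite hv ?mul0r.
  by rewrite v'0 ?mulr0//; lra.
have Evv' : EF v (v \o reflection true) = 0.
  apply: (EF_separated hK d0) => // x y Kx Ky.
  have cl : close d x y -> `|coord true x - coord true y| < d by case/andP.
  move=> /cl; rewrite ltr_norml => xy; rewrite /increment2.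
  have [hx|hx] := ltP (coord true x) (2^-1 + d).
    have [hy|hy] := ltP (coord true y) (2^-1 + d).
      by rewrite !hv// subrr mul0r.
    by rewrite !v'0// ?subrr ?mulr0//; lra.
  by rewrite !v'0// ?subrr ?mulr0//; lra.
have := odd_gap oo.
have Eo := NF_sqrD mu hK lam dv dv' oE.
have : NF lam v (v \o reflection true) = 0.
  by rewrite /NF Evv' (ip_eq0 hK hmu sep); ring.
have := NF_reflection hK hmu lam true dv dv.
by move: Eo; rewrite /NF => Eo E1 E2; rewrite -subr_ge0 Eo E1 E2; lra.
Qed.

(** Thresholding at [e] does not raise the energy, costs at most [2 * e * M] of [ip v v], and yields
    a function that splits into two halves without interaction. *)
Lemma center_gap v : dom v -> v c = 0 -> lam * ip v v <= EF v v.
Proof.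
move=> dv vc0; have [M M0 hM] := Kcont_bounded hK dv.1.
apply/ler_addgt0Pr => e0 e00.
(* Chosen so that the loss [lam * (2 * e * M)] is at most [e0]; [M + 1] avoids a division by 0. *)
pose e := e0 / (2 * lam * (M + 1)).
have k0 : 0 < 2 * lam * (M + 1) by rewrite !mulr_gt0//; lra.
have e_gt0 : 0 < e by rewrite divr_gt0.
have eE : lam * (2 * e * M) <= e0.
  have -> : e0 = e * (2 * lam * (M + 1)) by rewrite /e divfK// gt_eqF.
  have : 0 <= e * lam by rewrite ltW// mulr_gt0.
  by lra.
pose s := fun x => threshold e (v x).
have ds : dom s by exact: dom_threshold (ltW e_gt0) dv.
have [d d0 hd] := near_center hK dv.1 vc0 e_gt0.
have s0 b : vanishing K b d s.
  by move=> x Kx hx; apply: threshold_eq0; apply/ltW/(hd b).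
pose sR := cut true s; pose sL := fun x => s x - sR x.
have dR : dom sR := dom_cut hK d0 ds (s0 true).
have dL : dom sL.
  by apply: (dom_eq hK _ (domD hK ds (domZ hK (-1) dR))) => x _; rewrite /sL mulN1r.
have d20 : 0 < d / 2 by lra.
have hR : lam * ip sR sR <= EF sR sR.
  apply: (half_gap d20 dR) => x Kx hx; rewrite /sR /cut; case: ifP => // h.
  by apply: (s0 true) => //; rewrite ltr_norml; lra.
have hL : lam * ip sL sL <= EF sL sL.
  rewrite -(ip_reflection hK hmu true dL dL) -(EF_reflection true).
  apply: (half_gap d20 (dom_reflection hK true dL)) => x Kx hx.
  rewrite /comp /sL /sR /cut; have Krx := K_reflection hK true Kx.
  case: ifP => [_|h]; first by rewrite subrr.
  rewrite subr0; apply: (s0 true) => //.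
  by rewrite /reflection /coord /= in hx h *; rewrite ltr_norml; lra.
have sE x : K x -> s x = 1 * sR x + 1 * sL x by rewrite /sL; lra.
have RL : NF lam sR sL = 0.
  rewrite /NF (ip_eq0 hK hmu) ?mulr0 ?subr0; last first.
    by move=> x Kx; rewrite /sL /sR /cut; case: ifP; rewrite ?subrr ?mulr0 ?mul0r.
  apply: (EF_separated hK d0) => // x y Kx Ky xy.
  rewrite /increment2 /sL /sR; have := cut_cases d0 (s0 true) Kx Ky xy.
  by case=> [[-> ->]|[-> ->]|[-> -> -> ->]]; rewrite ?subrr ?mul0r ?mulr0.
have Es := NF_sqrD mu hK lam dR dL sE.
have sle : EF s s <= EF v v.
  apply: (EF_le hK ltr01) => // x y Kx Ky _; rewrite /increment2 -!expr2.
  by apply: le_sqr_norm; exact: threshold_lip (ltW e_gt0).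
have sge : ip v v - 2 * e * M <= ip s s.
  have vvc := KcontM dv.1 dv.1; have cc := @Kcont_cst _ K (2 * e * M).
  have <- : Kint K mu (fun x => 1 * (v x * v x) + (-1) * (2 * e * M)) = ip v v - 2 * e * M.
    by rewrite (Kint_lin mu hK)// (Kint_cst hK hmu) mul1r mulN1r.
  apply: (Kint_le mu hK); [|exact: KcontM ds.1 ds.1|].
    by apply: KcontD; apply: KcontM => //; exact: Kcont_cst.
  move=> x Kx; apply: le_trans (threshold_sqr_ge (v x) (ltW e_gt0)).
  by rewrite mul1r mulN1r lerB// ler_pM2l ?hM// mulr_gt0.
have : lam * ip s s <= EF s s by move: Es RL; rewrite /NF; lra.
have : lam * (ip v v - 2 * e * M) <= lam * ip s s by rewrite ler_pM2l.
lra.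
Qed.

End Gap.

(** * Positive and negative parts of an eigenfunction, and its zero at the centre *)

Section Eigenfunction.
Variables (R : realType) (K : set (R * R)) (mu : probability (R * R)%type R).
Hypotheses (hK : is_vicsek_set K) (hmu : self_similar_measure K mu).
Variable lam : R.
Hypothesis lam0 : 0 < lam.
Hypothesis center_gap : forall v, dom K v -> v (vc R) = 0 -> 0 <= NF K mu lam v v.
Implicit Types (p x y : R * R) (b : bool) (f g u v w : R * R -> R).
Local Notation dom := (dom K).
Local Notation ip := (ip K mu).
Local Notation NF := (NF K mu).
Local Notation c := (vc R).

Definition pos f x := Num.max (f x) 0.
Definition neg f x := Num.min (f x) 0.

Let posneg (t : R) : 0 <= t /\ Num.max t 0 = t /\ Num.min t 0 = 0 \/
  t <= 0 /\ Num.max t 0 = 0 /\ Num.min t 0 = t.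
Proof.
by have [h|h] := leP 0 t; [left|right]; rewrite ?(ltW h).
Qed.

Lemma dom_pos f : dom f -> dom (pos f).
Proof.
apply: (dom_lip hK (C := 1)) => x y _ _; rewrite mul1r /pos ler_normr !ler_norml.
by case: (posneg (f x)) => -[? [-> _]]; case: (posneg (f y)) => -[? [-> _]]; lra.
Qed.

Lemma dom_neg f : dom f -> dom (neg f).
Proof.
apply: (dom_lip hK (C := 1)) => x y _ _; rewrite mul1r /neg ler_normr !ler_norml.
by case: (posneg (f x)) => -[? [_ ->]]; case: (posneg (f y)) => -[? [_ ->]]; lra.
Qed.

Lemma pos_neg f x : f x = 1 * pos f x + 1 * neg f x.
Proof. by rewrite /pos /neg; case: (posneg (f x)) => -[? [-> ->]]; lra. Qed.

(** Both parts, [neg f] taken with its sign, are nondecreasing functions of [f], so their increments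
    never have opposite signs. *)
Lemma EF_pos_neg f : dom f -> 0 <= EF (pos f) (neg f).
Proof.
move=> df; rewrite -[leLHS](EF_cst 0 (fun=> 0)).
apply: (EF_le hK ltr01); [exact: dom_cst|exact: dom_cst|exact: dom_pos|exact: dom_neg|].
move=> x y _ _ _; rewrite /increment2 subrr mul0r /pos /neg.
by case: (posneg (f x)) => -[? [-> ->]]; case: (posneg (f y)) => -[? [-> ->]]; nra.
Qed.

Lemma NF_pos_neg l f : NF l (pos f) (neg f) = EF (pos f) (neg f).
Proof.
rewrite /NF (ip_eq0 hK hmu) ?mulr0 ?subr0// => x _; rewrite /pos /neg.
by case: (posneg (f x)) => -[_ [-> ->]]; rewrite ?mulr0 ?mul0r.
Qed.

Lemma NF_cst l g (a : R) : dom g -> NF l g (fun=> a) = - (l * a * ip g (fun=> 1)).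
Proof.
move=> dg; rewrite NFC.
have E x : K x -> a = a * 1 + 0 * 1 by move=> _; lra.
rewrite (@NF_lin _ _ mu hK l a 0 (fun=> a) (fun=> 1) (fun=> 1) g)//; try exact: dom_cst.
by rewrite mul0r addr0 /NF EF_cst (ipC _ _ _ g); ring.
Qed.

Lemma ip_cst_ge0 g : dom g -> (forall x, K x -> 0 <= g x) -> 0 <= ip g (fun=> 1).
Proof.
move=> dg g0; apply: (ip_ge0 hK hmu) => //; first exact: dom_cst.
by move=> x Kx; rewrite mulr1 g0.
Qed.

Lemma ip_cst_eq0 g : dom g -> (forall x, K x -> 0 <= g x) -> ip g (fun=> 1) = 0 ->
  forall x, K x -> g x = 0.
Proof.
move=> dg g0 h; apply: (Kint_pos hK hmu dg.1 g0).
by rewrite -h (_ : ip g _ = Kint K mu g)//; apply: Kint_eq => x _; rewrite mulr1.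
Qed.

Definition eigen u := dom u /\ forall v, dom v -> NF lam u v = 0.

(** The eigenvalue equation up to a point source at the centre. *)
Definition center_eigen f := dom f /\ forall v, dom v -> v c = 0 -> NF lam f v = 0.

Lemma eigen_opp u : eigen u -> eigen (fun x => - u x).
Proof.
move=> [du hu]; split.
  by apply: (dom_eq hK _ (domZ hK (-1) du)) => x _; rewrite mulN1r.
move=> v dv; rewrite (@NF_lin _ _ mu hK lam (-1) 0 (fun x => - u x) u u v)//.
  by rewrite hu//; lra.
by move=> x _; lra.
Qed.

Lemma eigen_mean u : eigen u -> ip u (fun=> 1) = 0.
Proof.
move=> [du hu]; have := hu _ (dom_cst K 1); rewrite NF_cst// mulr1 => /eqP.
by rewrite oppr_eq0 mulf_eq0 gt_eqF//= => /eqP.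
Qed.

Lemma center_minimizer f : dom f -> f c = 0 -> NF lam f f <= 0 -> center_eigen f.
Proof.
move=> df fc0 Nf; split=> // v dv vc0.
apply: (@minimizer_equation _ _ mu hK lam (fun v => dom v /\ v c = 0) f) => //.
- by move=> w [].
- move=> t w w' [dw wc] [dw' wc']; split; last by rewrite wc wc' mulr0 addr0.
  exact: (domD hK dw (domZ hK t dw')).
- by move=> w [dw wc]; exact: center_gap.
Qed.

Lemma eigen_neg u : eigen u -> NF lam (neg u) (neg u) = - EF (pos u) (neg u).
Proof.
move=> [du hu]; have := hu _ (dom_neg du).
rewrite (NF_lin mu hK lam (dom_pos du) (dom_neg du) (dom_neg du) (fun x _ => pos_neg u x)).
by rewrite NF_pos_neg; lra.
Qed.

Lemma eigen_pos u : eigen u -> NF lam (pos u) (pos u) = - EF (pos u) (neg u).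
Proof.
move=> [du hu]; have := hu _ (dom_pos du).
rewrite (NF_lin mu hK lam (dom_pos du) (dom_neg du) (dom_pos du) (fun x _ => pos_neg u x)).
by rewrite (NFC _ _ _ (neg u)) NF_pos_neg; lra.
Qed.

(* If u were positive at the centre, its negative part would vanish there and
   minimize the form; testing against 1 - pos u / u(c) shows it is zero. *)
Lemma eigen_center_le0 u : eigen u -> u c <= 0.
Proof.
move=> eu; have [du hu] := eu; rewrite leNgt; apply/negP => uc0.
have [_ _ _ _ Kc] := vq_K hK.
have dn := dom_neg du; have dp := dom_pos du.
have nc0 : neg u c = 0 by rewrite /neg min_r// ltW.
have pc : pos u c = u c by rewrite /pos max_l// ltW.
have Nn := eigen_neg eu.
have [_ hn] : center_eigen (neg u).
  by apply: center_minimizer => //; rewrite Nn oppr_le0; exact: EF_pos_neg.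
pose v x := 1 * 1 + (- (u c)^-1) * pos u x.
have dv : dom v := dom_lin hK 1 (- (u c)^-1) (dom_cst K 1) dp.
have vc0 : v c = 0 by rewrite /v pc mulNr mulVf ?gt_eqF// mul1r subrr.
have := hn v dv vc0.
rewrite NFC (NF_lin mu hK lam (dom_cst K 1) dp dn (fun x _ => erefl (v x))).
(* Tested against itself, [neg u] gives [EF (pos u) (neg u) = 0]; the cross term drops and only the
   mean of [neg u] is left. *)
rewrite NF_pos_neg; have := hn _ dn nc0; rewrite Nn => /eqP; rewrite oppr_eq0 => /eqP ->.
rewrite mulr0 addr0 mul1r NFC NF_cst// mulr1 => /eqP.
rewrite oppr_eq0 mulf_eq0 gt_eqF//= => /eqP In.
have n0 : forall x, K x -> neg u x = 0.
  move=> x Kx; apply/eqP; rewrite -oppr_eq0; apply/eqP.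
  have dn' : dom (fun x => - neg u x).
    by apply: (dom_eq hK _ (domZ hK (-1) dn)) => y _; rewrite mulN1r.
  apply: (ip_cst_eq0 dn') => // [y _|]; first by rewrite oppr_ge0 /neg ge_min lexx orbT.
  rewrite (@ip_lin _ _ mu hK (-1) 0 (fun x => - neg u x) (neg u) (neg u))//.
  - by rewrite In; lra.
  - exact: dom_cst.
  - by move=> y _; lra.
have u0 x : K x -> 0 <= u x.
  by move=> Kx; rewrite (pos_neg u x) n0// /pos mulr0 addr0 mul1r le_max lexx orbT.
by move: uc0; rewrite (ip_cst_eq0 du u0 (eigen_mean eu) Kc) ltxx.
Qed.

Lemma eigen_center u : eigen u -> u c = 0.
Proof.
move=> eu; have := eigen_center_le0 eu; have := eigen_center_le0 (eigen_opp eu).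
lra.
Qed.

(** Testing the equation of [u] with [pos u] gives [NF lam (pos u) (pos u) = - EF (pos u) (neg u) <=
    0], so [pos u] minimizes the form among functions vanishing at [c]. *)
Lemma center_eigen_pos u : eigen u -> center_eigen (pos u).
Proof.
move=> eu; apply: center_minimizer; first exact: dom_pos eu.1.
  by rewrite /pos (eigen_center eu) maxxx.
by rewrite (eigen_pos eu) oppr_le0; exact: EF_pos_neg eu.1.
Qed.

Lemma center_eigen_reflection b f : center_eigen f -> center_eigen (f \o reflection b).
Proof.
move=> [df hf]; split=> [|v dv vc0]; first exact: dom_reflection.
have rv := dom_reflection hK b dv.
rewrite -(NF_reflection hK hmu lam b) //; last exact: dom_reflection.
have E g : (g \o reflection b) \o reflection b = g by apply/funext => x /=; rewrite reflectionK.
by rewrite E; apply: hf => //=; rewrite reflection_center.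
Qed.

End Eigenfunction.

(** * Solutions with a source at a corner, and their restriction to cells *)

Section Sources.
Variables (R : realType) (K : set (R * R)) (mu : probability (R * R)%type R).
Hypotheses (hK : is_vicsek_set K) (hmu : self_similar_measure K mu).
Variable lam : R.
Hypothesis lam0 : 0 < lam.
Hypothesis center_gap : forall v, dom K v -> v (vc R) = 0 -> 0 <= NF K mu lam v v.
Implicit Types (p x y : R * R) (b : bool) (f g h u v w : R * R -> R) (l : R).
Local Notation dom := (dom K).
Local Notation ip := (ip K mu).
Local Notation NF := (NF K mu).
Local Notation F := (@vicsek_map R).
Local Notation centers := (vicsek_centers R).
Local Notation q1 := (vq1 R).
Local Notation q2 := (vq2 R).
Local Notation q3 := (vq3 R).
Local Notation q4 := (vq4 R).
Local Notation c := (vc R).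

Let q1c : q1 \in centers. Proof. by apply/mem_centersP; left; constructor 1. Qed.
Let q2c : q2 \in centers. Proof. by apply/mem_centersP; left; constructor 2. Qed.
Let q3c : q3 \in centers. Proof. by apply/mem_centersP; left; constructor 3. Qed.
Let q4c : q4 \in centers. Proof. by apply/mem_centersP; left; constructor 4. Qed.
Let cc : c \in centers. Proof. by apply/mem_centersP; right. Qed.

(** Test functions on [K] assembled from [h] on the cell of [q2] and [g] on the central cell. The
    closed squares overlap at junction points; the conditions on the corner values make the choice
    of branch there immaterial. *)
Definition glue g h x : R :=
  if (2 / 3 <= x.1) && (2 / 3 <= x.2) then h (vicsek_unmap q2 x)
  else if (3^-1 <= x.1 <= 2 / 3) && (3^-1 <= x.2 <= 2 / 3) then g (vicsek_unmap c x)
  else 0.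

Section Glue.
Variables (g h : R * R -> R).
Hypotheses (gh : g q2 = h q4) (g1 : g q1 = 0) (g3 : g q3 = 0) (g4 : g q4 = 0).

Lemma glue_q2 x : K x -> glue g h (F q2 x) = h x.
Proof.
move=> Kx; rewrite /glue vicsek_mapK vicsek_mapE /= ifT//.
by have := K_box hK Kx; lra.
Qed.

Lemma glue_c x : K x -> glue g h (F c x) = g x.
Proof.
move=> Kx; have := K_box hK Kx => bx; rewrite /glue.
case: ifP => [hx|_]; last by rewrite vicsek_mapK vicsek_mapE /= ifT//; lra.
rewrite vicsek_mapE /= in hx.
have -> : x = q2 by case: x {Kx} bx hx => s t /= ? ?; congr pair; lra.
have [_ <- _ _] := vicsek_junctions R.
by rewrite vicsek_mapK.
Qed.

Lemma glue_0 p x : [\/ p = q1, p = q3 | p = q4] -> K x -> glue g h (F p x) = 0.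
Proof.
move=> pE Kx; have := K_box hK Kx => bx; rewrite /glue.
rewrite ifF; last first.
  by rewrite vicsek_mapE; apply/negP => /= hx; case: pE hx => -> /=; lra.
case: ifP => // hx; have [j1 _ j3 j4] := vicsek_junctions R.
case: pE hx => -> hx; rewrite vicsek_mapE /= in hx.
- have -> : x = q3 by case: x {Kx} bx hx => s t /= ? ?; congr pair; lra.
  by rewrite j1 vicsek_mapK.
- have -> : x = q1 by case: x {Kx} bx hx => s t /= ? ?; congr pair; lra.
  by rewrite j3 vicsek_mapK.
- have -> : x = q2 by case: x {Kx} bx hx => s t /= ? ?; congr pair; lra.
  by rewrite j4 vicsek_mapK.
Qed.

Lemma dom_glue : dom g -> dom h -> dom (glue g h).
Proof.
move=> dg dh; apply: (dom_cells hK) => p /mem_centersP[pE|->]; last first.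
  by apply: (dom_eq hK _ dg) => x Kx; rewrite /= glue_c.
have dz := dom_cst K 0.
case: pE => pE; rewrite ?pE.
- by apply: (dom_eq hK _ dz) => x Kx; rewrite /= glue_0//; constructor 1.
- by apply: (dom_eq hK _ dh) => x Kx; rewrite /= glue_q2.
- by apply: (dom_eq hK _ dz) => x Kx; rewrite /= glue_0//; constructor 2.
- by apply: (dom_eq hK _ dz) => x Kx; rewrite /= glue_0//; constructor 3.
Qed.

(** The energy of a cell counts with weight 3 and its mass with weight [1 / 5], so factoring out 3
    leaves [l / 15]. *)
Lemma NF_cells l f v : dom f -> dom v ->
  NF l f v = 3 * \sum_(p <- centers) NF (l / 15) (f \o F p) (v \o F p).
Proof.
move=> df dv; rewrite /NF (EF_cells hK df dv) /ip.
rewrite (Kint_self hmu (KcontM df.1 dv.1)) !big_centers; lra.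
Qed.

Lemma NF_glue l f : dom f -> dom g -> dom h ->
  NF l f (glue g h) = 3 * (NF (l / 15) (f \o F q2) h + NF (l / 15) (f \o F c) g).
Proof.
move=> df dg dh; rewrite NF_cells//; last exact: dom_glue.
have E0 p : p \in centers -> [\/ p = q1, p = q3 | p = q4] ->
    NF (l / 15) (f \o F p) (glue g h \o F p) = 0.
  move=> pc pE; rewrite (NF_eq mu hK _ (f' := f \o F p) (g' := fun=> 0))//.
    by rewrite (NF_cst mu hK)//; [lra|exact: (dom_map hK)].
  by move=> x Kx; rewrite /= glue_0.
rewrite big_centers (E0 q1 q1c (Or31 _ _ erefl)) (E0 q3 q3c (Or32 _ _ erefl)).
rewrite (E0 q4 q4c (Or33 _ _ erefl)).
rewrite (NF_eq mu hK (l / 15) (f := f \o F q2) (f' := f \o F q2) (g' := h))//; last first.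
  by move=> x Kx; rewrite /= glue_q2.
rewrite (NF_eq mu hK (l / 15) (f := f \o F c) (f' := f \o F c) (g' := g))//; last first.
  by move=> x Kx; rewrite /= glue_c.
lra.
Qed.

End Glue.

Definition quadrant_test v := dom v /\
  forall x, K x -> (x.1 <= 2^-1) || (x.2 <= 2^-1) -> v x = 0.

(* Solutions of the eigenvalue equation on the quadrant at q2 with a
   nonnegative source at q2. *)
Definition quadrant_source l f := [/\ dom f, forall x, K x -> 0 <= f x
  & exists2 a, 0 <= a & forall v, quadrant_test v -> NF l f v = a * v q2].

(* Solutions on all of K with a source at q2 and a sink at q4. *)
Definition source_sink l f := [/\ dom f, forall x, K x -> 0 <= f x
  & exists a b : R, [/\ 0 <= a, 0 <= b
    & forall v, dom v -> NF l f v = a * v q2 - b * v q4]].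

Lemma quadrant_test_corners v : quadrant_test v -> [/\ v q1 = 0, v q3 = 0 & v q4 = 0].
Proof.
move=> [_ hv]; have [K1 _ K3 K4 _] := vq_K hK.
by split; apply: hv => //=; lra.
Qed.

Lemma cell_ge0 f p : p \in centers -> (forall x, K x -> 0 <= f x) ->
  forall x, K x -> 0 <= (f \o F p) x.
Proof. by move=> pc f0 x Kx; apply: f0; exact: K_map. Qed.

Lemma source_mass_ge0 l f (a : R) : 0 <= l -> 0 <= a -> dom f -> (forall x, K x -> 0 <= f x) ->
  0 <= a / 3 + l / 15 * ip (f \o F q2) (fun=> 1).
Proof.
move=> l0 a0 df f0; rewrite addr_ge0 ?divr_ge0// mulr_ge0 ?divr_ge0//.
by apply: (ip_cst_ge0 hK hmu); [exact: (dom_map hK)|exact: cell_ge0].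
Qed.

(** A test [v] on the central cell is extended by the constant [v q2] over the corner cell. The
    constant has no energy there and picks up only the mass of [f], which joins the old source. *)
Lemma quadrant_source_center l f : 0 <= l ->
  quadrant_source l f -> quadrant_source (l / 15) (f \o F c).
Proof.
move=> l0 [df f0 [a a0 hf]]; split; [exact: (dom_map hK)|exact: cell_ge0|].
exists (a / 3 + l / 15 * ip (f \o F q2) (fun=> 1)); first exact: source_mass_ge0.
move=> v tv; have [v1 v3 v4] := quadrant_test_corners tv; have [dv hv] := tv.
have dk : dom (fun=> v q2) := dom_cst K (v q2).
pose V := glue v (fun=> v q2).
have dV : dom V by exact: dom_glue.
have [K1 K2 K3 K4 Kc] := vq_K hK.
have Vq2 : V q2 = v q2 by rewrite -{1}(vicsek_map_fix q2) /V glue_q2.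
have tV : quadrant_test V.
  split=> // x Kx; have [p pc [z Kz ->]] := K_case hK Kx; have bz := K_box hK Kz.
  case/mem_centersP: pc => [[]|] -> hx.
  - by rewrite /V glue_0//; constructor 1.
  - by move: hx; rewrite vicsek_mapE /=; lra.
  - by rewrite /V glue_0//; constructor 2.
  - by rewrite /V glue_0//; constructor 3.
  - rewrite /V glue_c//; apply: hv => //; move: hx; rewrite vicsek_mapE /=.
    by case/orP => ?; apply/orP; [left|right]; lra.
have := hf V tV; rewrite /V NF_glue// -/V Vq2 (NF_cst mu hK)//; last exact: (dom_map hK).
lra.
Qed.

(** Here the test is [v - v q4] on the corner cell, continued by 0. The constant removed produces
    the sink, of the same strength as the source received by the central cell. *)
Lemma quadrant_source_corner l f : 0 <= l ->
  quadrant_source l f -> source_sink (l / 15) (f \o F q2).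
Proof.
move=> l0 [df f0 [a a0 hf]]; split; [exact: (dom_map hK)|exact: cell_ge0|].
exists (a / 3), (a / 3 + l / 15 * ip (f \o F q2) (fun=> 1)); split.
- by rewrite divr_ge0.
- exact: source_mass_ge0.
move=> v dv; have dk : dom (fun=> - v q4) := dom_cst K _.
have dz : dom (fun=> 0) := dom_cst K 0.
pose h := fun x => v x + (- v q4); have dh : dom h by exact: domD.
have h4 : 0 = h q4 by rewrite /h subrr.
pose V := glue (fun=> 0) h.
have dV : dom V by exact: dom_glue.
have [K1 K2 K3 K4 Kc] := vq_K hK.
have Vq2 : V q2 = h q2 by rewrite -{1}(vicsek_map_fix q2) /V glue_q2.
have tV : quadrant_test V.
  split=> // x Kx; have [p pc [z Kz ->]] := K_case hK Kx; have bz := K_box hK Kz.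
  case/mem_centersP: pc => [[]|] -> hx.
  - by rewrite /V glue_0//; constructor 1.
  - by move: hx; rewrite vicsek_mapE /=; lra.
  - by rewrite /V glue_0//; constructor 2.
  - by rewrite /V glue_0//; constructor 3.
  - by rewrite /V glue_c.
have d2 : dom (f \o F q2) by exact: (dom_map hK).
have := hf V tV; rewrite /V NF_glue// -/V Vq2 [NF _ _ (fun=> 0)](NF_cst mu hK)//; last exact: (dom_map hK).
rewrite NFC (@NF_lin _ _ mu hK (l / 15) 1 (- v q4) h v (fun=> 1) (f \o F q2))//; first last.
- by move=> x _; rewrite /h; lra.
- exact: dom_cst.
rewrite NFC [NF _ (fun=> 1) _]NFC (NF_cst mu hK)// /h; lra.
Qed.

Lemma source_sink_quadrant l f : source_sink l f -> quadrant_source l f.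
Proof.
move=> [df f0 [a [b [a0 b0 hf]]]]; split=> //; exists a => // v tv.
by have [_ _ v4] := quadrant_test_corners tv; rewrite hf ?v4; [lra|exact: tv.1].
Qed.

(* The form is tested with s - s o r, where r is the reflection and s is the
   part above e of f o r - f on the half where the source lies. *)
Lemma source_sink_reflection l b f x : 0 <= l -> l < lam -> source_sink l f ->
  K x -> 2^-1 <= coord b x -> f (reflection b x) <= f x.
Proof.
move=> l0 llam [df f0 [a [a' [a0 a'0 hf]]]] Kx xb.
rewrite leNgt; apply/negP => fx.
have [K1 K2 K3 K4 Kc] := vq_K hK.
have dr := dom_reflection hK b df.
pose d y := 1 * (f \o reflection b) y + (-1) * f y.
have dd : dom d by exact: (dom_lin hK).
have d_c : d c = 0 by rewrite /d /= reflection_center; lra.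
have dx0 : 0 < d x by rewrite /d /=; lra.
have [M M0 hM] := Kcont_bounded hK dd.1.
(* On the mirror line [d] vanishes at [c] but is only small nearby; the level [e] makes [t e] vanish
   on a strip, so that cutting keeps it in the domain. *)
pose t e y := pos (fun z => d z - e) y.
pose s e := cut b (t e).
have posE (e : R) y : 0 < e -> e <= d y /\ t e y = d y - e \/ d y <= e /\ t e y = 0.
  by move=> e0; rewrite /t /pos; have [h|h] := leP (d y - e) 0; [right|left]; lra.
have key e : 0 < e -> dom (s e) /\ (lam - l) * ip (s e) (s e) <= l * (e * M).
  move=> e0.
  have dt : dom (t e).
    by apply: (dom_pos hK); exact: (domD hK dd (dom_cst K (- e))).
  have [dl dl0 hdl] := near_center hK dd.1 d_c e0.
  have vt : vanishing K b dl (t e).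
    move=> y Ky /(hdl b y Ky); rewrite ltr_norml => /andP[h1 h2].
    by case: (posE e y e0) => -[? ->]; lra.
  have ds : dom (s e) := dom_cut hK dl0 dt vt.
  have drs := dom_reflection hK b ds.
  split=> //.
  have sc : s e c = 0.
    rewrite /s /cut /t /pos d_c max_r ?if_same//; lra.
  (* With [r] the reflection, the form equals [NF l f (s o r) - NF l f s]. The half carrying [s]
     contains [q2] and not [q4], so the first term sees only the sink and the second only the
     source. *)
  have NFds : NF l d (s e) <= 0.
    rewrite (NF_lin mu hK l dr df ds (fun y _ => erefl (d y))).
    have -> : NF l (f \o reflection b) (s e) = NF l f (s e \o reflection b).
      rewrite -(NF_reflection hK hmu l b df drs); apply: (NF_eq mu hK) => // y _.
      by rewrite /comp reflectionK.
    rewrite !hf// /s /cut /=.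
    have s0 y : 0 <= t e y by rewrite /t /pos le_max lexx orbT.
    have := s0 q2; have := s0 (reflection b q4).
    have n1 : (2^-1 <= (0 : R)) = false by lra.
    have n2 : (2^-1 <= (1 : R)) by lra.
    rewrite /reflection /coord /vq2 /vq4; case: (b) => /=;
      rewrite ?subrr ?subr0 ?n1 ?n2 => ? ?; nra.
  have Ele : EF (s e) (s e) <= EF d (s e).
    apply: (EF_le hK dl0) => // y z Ky Kz yz; rewrite /increment2 /s.
    case: (cut_cases dl0 vt Ky Kz yz) => [[-> ->]|[-> ->]|[-> -> _ _]].
    - by case: (posE e y e0) => -[? ->]; case: (posE e z e0) => -[? ->]; nra.
    - by rewrite subrr !mulr0.
    - by rewrite subrr !mulr0.
  have s1 y : K y -> 0 <= s e y <= M.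
    move=> Ky; have := hM y Ky; rewrite ler_norml => /andP[? ?].
    rewrite /s /cut; case: ifP => _; last lra.
    by case: (posE e y e0) => -[? ->]; lra.
  (* Where [s e] is nonzero, [d = s e + e]; the extra term is the truncation error, at most
     [e * M]. *)
  have ipE : ip d (s e) = ip (s e) (s e) + e * ip (s e) (fun=> 1).
    have E y : K y -> d y * s e y = 1 * (s e y * s e y) + e * (s e y * 1).
      move=> Ky; rewrite /s /cut; case: ifP => _; last by rewrite !mulr0 mul0r !mulr0; lra.
      by case: (posE e y e0) => -[? ->]; lra.
    rewrite /ip (Kint_eq mu E) (Kint_lin mu hK) ?mul1r//; first exact: KcontM ds.1 ds.1.
    by apply: KcontM; [exact: ds.1|exact: Kcont_cst].
  have ip1 : ip (s e) (fun=> 1) <= M.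
    rewrite -[leRHS](Kint_cst hK hmu); apply: (Kint_le mu hK); [|exact: Kcont_cst|].
      by apply: KcontM; [exact: ds.1|exact: Kcont_cst].
    by move=> y /s1 /andP[_ ?]; rewrite mulr1.
  have gap := center_gap ds sc.
  have : e * ip (s e) (fun=> 1) <= e * M by rewrite ler_pM2l.
  move: NFds gap; rewrite /NF ipE => NFds gap h.
  have : l * (e * ip (s e) (fun=> 1)) <= l * (e * M) by rewrite ler_wpM2l.
  lra.
(* Half of [d x] keeps [s e0] positive at [x]. As [s e] grows when [e] decreases, the bound of order
   [e] on [ip (s e) (s e)] forces [s e0] to vanish. *)
pose e0 := d x / 2; have e00 : 0 < e0 by rewrite /e0; lra.
have [ds0 _] := key e0 e00.
have ip0 : ip (s e0) (s e0) <= 0.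
  apply/ler_addgt0Pr => r r0; rewrite add0r.
  have k0 : 0 < l * M + 1 by rewrite ltr_wpDl// mulr_ge0.
  have ll0 : 0 < lam - l by rewrite subr_gt0.
  pose e := Num.min e0 (r * (lam - l) / (l * M + 1)).
  have e_gt0 : 0 < e by rewrite lt_min e00 divr_gt0// mulr_gt0.
  have [ds he] := key e e_gt0.
  have le_ip : ip (s e0) (s e0) <= ip (s e) (s e).
    apply: (Kint_le mu hK); [exact: KcontM ds0.1 ds0.1|exact: KcontM ds.1 ds.1|].
    move=> y Ky; have ee : e <= e0 by rewrite ge_min lexx.
    rewrite /s /cut; case: ifP => _; last by rewrite mulr0.
    by case: (posE e y e_gt0) => -[? ->]; case: (posE e0 y e00) => -[? ->]; nra.
  apply: (le_trans le_ip); rewrite -(ler_pM2l ll0); apply: (le_trans he).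
  have : e <= r * (lam - l) / (l * M + 1) by rewrite ge_min lexx orbT.
  rewrite ler_pdivlMr//; lra.
have := ip_definite hK hmu ds0 ip0 Kx.
rewrite /s /cut xb; case: (posE e0 x e00) => -[h ->]; rewrite /e0 in h *; lra.
Qed.

Lemma source_sink_fold l f x : 0 <= l -> l < lam -> source_sink l f -> K x ->
  exists y, [/\ K y, 2^-1 <= y.1, 2^-1 <= y.2 & f x <= f y].
Proof.
move=> l0 llam sf Kx.
have step b z : K z -> exists y, [/\ K y, 2^-1 <= coord b y,
    coord (~~ b) y = coord (~~ b) z & f z <= f y].
  move=> Kz; have [hz|hz] := leP 2^-1 (coord b z); first by exists z.
  exists (reflection b z); split.
  - exact: K_reflection.
  - by move: hz; rewrite /reflection /coord; case: (b) => /=; lra.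
  - by rewrite /reflection /coord; case: (b).
  have := @source_sink_reflection l b f (reflection b z) l0 llam sf (K_reflection hK b Kz).
  rewrite reflectionK; apply.
  by move: hz; rewrite /reflection /coord; case: (b) => /=; lra.
have [y [Ky y1 _ xy]] := step true x Kx.
have [z [Kz z2 z1 yz]] := step false y Ky.
by exists z; split=> //; [move: z1 y1 => /= ->|exact: le_trans yz].
Qed.

(** A point of the quadrant lies in the cell of [q2], where reflections fold it into the quadrant of
    that cell, or in the central cell, where induction leads to the junction [F c q2 = F q2 q4]; two
    reflections inside the corner cell then carry [q4] to [q2]. Reflections need a constant below
    [lam], and [l / 15] is one even for [l = lam]. *)
Lemma quadrant_source_max n l f (D : R) x : 0 <= l -> l <= lam -> quadrant_source l f ->
  0 <= D -> (forall m, En m f f <= D ^+ 2) -> K x -> 2^-1 <= x.1 -> 2^-1 <= x.2 ->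
  f x <= f q2 + 9 * D * (3 / 5) ^+ n.
Proof.
have [K1 K2 K3 K4 Kc] := vq_K hK.
elim: n l f D x => [|n IH] l f D x l0 llam sf D0 fD Kx x1 x2.
  have [df _ _] := sf; rewrite expr0 mulr1.
  by have := dom_diameter hK D0 df.1 fD Kx K2; rewrite ler_norml; lra.
have l'0 : 0 <= l / 15 by rewrite divr_ge0.
have l'lam : l / 15 < lam by rewrite ltr_pdivrMr//; move: l0 llam lam0; lra.
have D'0 : 0 <= 3 / 5 * D by lra.
have sink := quadrant_source_corner l0 sf.
have E : 9 * D * (3 / 5) ^+ n.+1 = 9 * (3 / 5 * D) * (3 / 5) ^+ n by rewrite exprS; ring.
have F22 : F q2 q2 = q2 := vicsek_map_fix _.
have [p pc [z Kz xE]] := K_case hK Kx.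
have bz := K_box hK Kz; rewrite E {E}; move: x1 x2; rewrite xE.
case/mem_centersP: pc xE => [[]|] -> xE x1 x2.
- by move: x1; rewrite vicsek_mapE /=; lra.
- have [y [Ky y1 y2 zy]] := source_sink_fold l'0 l'lam sink Kz.
  apply: (le_trans zy).
  have := IH _ _ _ y l'0 (ltW l'lam) (source_sink_quadrant sink) D'0
    (fun m => En_cell_le m fD q2c) Ky y1 y2.
  by rewrite /= F22.
- by move: x2; rewrite vicsek_mapE /=; lra.
- by move: x2; rewrite vicsek_mapE /=; lra.
have z1 : 2^-1 <= z.1 by move: x1; rewrite vicsek_mapE /=; lra.
have z2 : 2^-1 <= z.2 by move: x2; rewrite vicsek_mapE /=; lra.
have := IH _ _ _ z l'0 (ltW l'lam) (quadrant_source_center l0 sf) D'0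
  (fun m => En_cell_le m fD cc) Kz z1 z2.
rewrite /=; move/le_trans; apply; rewrite lerD2r.
have [_ <- _ _] := vicsek_junctions R.
have := source_sink_reflection (b := true) l'0 l'lam sink K3.
have := source_sink_reflection (b := false) l'0 l'lam sink K2.
rewrite /reflection /= subrr F22 => h1 h2.
have n2 : (2^-1 <= (1 : R)) by lra.
exact: le_trans (h2 n2) (h1 n2).
Qed.

End Sources.

(** * From the quadrant to all of [K], and from the positive part to [u] *)

Section Extrema.
Variables (R : realType) (K : set (R * R)) (mu : probability (R * R)%type R).
Hypotheses (hK : is_vicsek_set K) (hmu : self_similar_measure K mu).
Variable lam : R.
Hypothesis lam0 : 0 < lam.
Hypothesis center_gap : forall v, dom K v -> v (vc R) = 0 -> 0 <= NF K mu lam v v.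
Implicit Types (x : R * R) (b : bool) (f u v : R * R -> R).

Lemma center_eigen_quadrant_max f x : center_eigen K mu lam f ->
  (forall y, K y -> 0 <= f y) -> K x -> 2^-1 <= x.1 -> 2^-1 <= x.2 -> f x <= f (vq2 R).
Proof.
move=> [df hf] f0 Kx x1 x2; have [D D0 hD] := dom_bound df.
have [_ _ _ _ Kc] := vq_K hK.
have sf : quadrant_source K mu lam f.
  (* The source has strength 0: a quadrant test vanishes on the closed border of the quadrant, hence
     at [c]. *)
  split=> //; exists 0 => // v [dv tv]; rewrite mul0r; apply: hf => //.
  by apply: tv => //=; rewrite lexx.
apply/ler_addgt0Pr => e e0; have [n hn] := exp35_small (9 * D) e0.
have := quadrant_source_max hK hmu lam0 center_gap n (ltW lam0) (lexx lam) sf D0 hD Kx x1 x2.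
lra.
Qed.

Lemma boundary_reflection b (q : R * R) :
  q \in vicsek_boundary R -> reflection b q \in vicsek_boundary R.
Proof.
rewrite !mem_boundary !inE => h.
by case/or4P: h => /eqP->; case: b; rewrite /reflection /= ?subr0 ?subrr eqxx ?orbT.
Qed.

Lemma center_eigen_max f x : center_eigen K mu lam f -> (forall y, K y -> 0 <= f y) -> K x ->
  exists2 q, q \in vicsek_boundary R & f x <= f q.
Proof.
move=> ef f0 Kx.
have step b (P : R * R -> Prop) :
    (forall g y, center_eigen K mu lam g -> (forall z, K z -> 0 <= g z) -> K y -> P y ->
       2^-1 <= coord b y -> exists2 q, q \in vicsek_boundary R & g y <= g q) ->
    (forall y, P y -> P (reflection b y)) ->
    forall g y, center_eigen K mu lam g -> (forall z, K z -> 0 <= g z) -> K y -> P y ->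
       exists2 q, q \in vicsek_boundary R & g y <= g q.
  move=> h hP g y eg g0 Ky Py; have [hy|hy] := leP 2^-1 (coord b y); first exact: h.
  have [|z Kz||||q qb] := h (g \o reflection b) (reflection b y).
  - exact: center_eigen_reflection.
  - by apply: g0; exact: K_reflection.
  - exact: K_reflection.
  - exact: hP.
  - by move: hy; rewrite /reflection /coord; case: (b) => /=; lra.
  by rewrite /= reflectionK => hq; exists (reflection b q) => //; exact: boundary_reflection.
have s1 := step true (fun y => 2^-1 <= coord false y); have s2 := step false (fun=> True).
apply: s2 ef f0 Kx I => // g y eg g0 Ky _ y2; apply: s1 eg g0 Ky y2 => // g' z eg' g'0 Kz z2 z1.
exists (vq2 R); last exact: center_eigen_quadrant_max.
by rewrite mem_boundary !inE eqxx orbT.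
Qed.

Lemma boundary_argmax f : exists2 q, q \in vicsek_boundary R &
  forall q', q' \in vicsek_boundary R -> f q' <= f q.
Proof.
suff [q qs hq] : exists2 q, q \in vicsek_corners R &
    forall q', q' \in vicsek_corners R -> f q' <= f q.
  by exists q => [|q']; rewrite mem_boundary// => /hq.
rewrite /vicsek_corners; elim: [:: (1, 1); _; _] (0, 1) => [|a s IH] z.
  by exists z => [|q]; rewrite inE// => /eqP->.
have [q qs hq] := IH a; have [h|h] := leP (f z) (f q).
  by exists q => [|q']; rewrite inE ?qs ?orbT// => /orP[/eqP->//|/hq].
exists z => [|q']; rewrite inE ?eqxx// => /orP[/eqP->//|/hq hq'].
exact: le_trans hq' (ltW h).
Qed.

Lemma eigen_max u : eigen K mu lam u -> (exists2 x, K x & u x != 0) ->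
  exists2 q, q \in vicsek_boundary R & forall x, K x -> u x <= u q.
Proof.
move=> eu [x0 Kx0 ux0].
have ep := center_eigen_pos hK hmu lam0 center_gap eu.
have p0 y : K y -> 0 <= pos u y by rewrite /pos le_max lexx orbT.
have up y : u y <= pos u y by rewrite /pos le_max lexx.
have [q qb hq] := boundary_argmax (pos u).
have pmax x : K x -> pos u x <= pos u q.
  by move=> Kx; have [q' q'b h] := center_eigen_max ep p0 Kx; exact: le_trans h (hq _ q'b).
exists q => // x Kx; apply: (le_trans (up x)); apply: (le_trans (pmax x Kx)).
(* If [u q < 0], the maximum of [pos u] is 0 and [u] is nowhere positive; having mean 0, it would
   vanish identically. *)
have [uq|uq] := leP 0 (u q); first by rewrite /pos max_l.
have u_le0 y : K y -> 0 <= - u y.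
  move=> Ky; rewrite oppr_ge0; apply: (le_trans (up y)); apply: (le_trans (pmax y Ky)).
  by rewrite /pos max_r ?(ltW uq).
have eo := eigen_opp hK eu.
have := ip_cst_eq0 hK hmu eo.1 u_le0 (eigen_mean hK lam0 eo) Kx0.
by move/eqP; rewrite oppr_eq0 (negbTE ux0).
Qed.

End Extrema.

(** * Translation of the Neumann eigenvalue problem into [NF] *)

Section Spectrum.
Variables (R : realType) (K : set (R * R)) (mu : probability (R * R)%type R).
Hypotheses (hK : is_vicsek_set K) (hmu : self_similar_measure K mu).
Implicit Types (l : R) (u : R * R -> R).

Lemma neumann_eigenfunctionP l u : neumann_eigenfunction K mu l u <->
  [/\ dom K u, exists2 x, K x & u x != 0 & forall v, dom K v -> NF K mu l u v = 0].
Proof.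
split=> [[/(dom_energyP hK) du u0 hu]|[du u0 hu]].
  split=> // v dv; have /(dom_energyP hK) dv' := dv.
  by rewrite /NF -(energy_formE hK du dv) hu// subrr.
split=> // [|v /(dom_energyP hK) dv]; first exact/(dom_energyP hK).
by rewrite (energy_formE hK du dv); apply/eqP; rewrite -subr_eq0; apply/eqP/hu.
Qed.

Lemma neumann_eigenvalue_ge0 l : neumann_eigenvalues K mu l -> 0 <= l.
Proof.
move=> [u /neumann_eigenfunctionP[du [x Kx ux] /(_ u du)]].
rewrite /NF => /eqP; rewrite subr_eq0 => /eqP E.
have : 0 < ip K mu u u.
  by rewrite ltNge; apply/negP => /(ip_definite hK hmu du)/(_ x Kx) u0; rewrite u0 eqxx in ux.
by move=> h; rewrite -(pmulr_lge0 _ h) -E (EF_ge0 hK du).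
Qed.

Lemma neumann_eigenvalue0 : neumann_eigenvalues K mu 0.
Proof.
have [_ _ _ _ Kc] := vq_K hK.
exists (fun=> 1); apply/neumann_eigenfunctionP; split; first exact: dom_cst.
  by exists (vc R) => //; rewrite oner_eq0.
by move=> v dv; rewrite /NF EF_cst mul0r subrr.
Qed.

End Spectrum.


Theorem theorem3p1 (R : realType) (K : set (R * R))
    (mu : probability (R * R)%type R) (lambda : R) (u : R * R -> R)
    (hK : is_vicsek_set K) (hmu : self_similar_measure K mu)
    (hlambda : second_least (neumann_eigenvalues K mu) lambda)
    (hu : neumann_eigenfunction K mu lambda u) :
  (exists2 q, q \in vicsek_boundary R & forall x, K x -> u x <= u q) /\
  (exists2 q, q \in vicsek_boundary R & forall x, K x -> u q <= u x).
Proof.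
have [x0 [Ax0 minx0] [[Alam lamx0] minlam]] := hlambda.
have x00 : x0 = 0.
  apply/le_anti; rewrite (neumann_eigenvalue_ge0 hK hmu Ax0) andbT.
  exact/minx0/neumann_eigenvalue0.
have lam0 : 0 < lambda.
  rewrite lt_neqAle (neumann_eigenvalue_ge0 hK hmu Alam) andbT eq_sym.
  by apply/eqP => h; apply: lamx0; rewrite /= h x00.
have least l g : 0 < l -> dom K g -> (exists2 x, K x & g x != 0) ->
    (forall v, dom K v -> NF K mu l g v = 0) -> lambda <= l.
  move=> l0 dg g0 hg; apply: minlam; split; last by rewrite /= x00 => h; rewrite h ltxx in l0.
  by exists g; apply/(neumann_eigenfunctionP mu hK).
have gap v : dom K v -> v (vc R) = 0 -> 0 <= NF K mu lambda v v.
  by move=> dv vc0; rewrite subr_ge0; exact: (center_gap hK hmu lam0 least).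
have [du u0 hu'] := (neumann_eigenfunctionP mu hK lambda u).1 hu.
have eu : eigen K mu lambda u by [].
split; first exact: (eigen_max hK hmu lam0 gap eu u0).
have [|q qb hq] := eigen_max hK hmu lam0 gap (eigen_opp hK eu).
  by case: u0 => x Kx ux; exists x => //; rewrite oppr_eq0.
by exists q => // x /hq; rewrite lerN2.
Qed.
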